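(* Every outerplanar graph $G$ has $\operatorname{tlir}(G) \leq 3$.
   Context: Graphs are finite and simple. A total coloring of $G$ assigns a color to every vertex and every edge. For a color $c$ and a vertex $v$, the total $c$-degree of $v$ is the number of edges of color $c$ incident to $v$, plus $1$ if $v$ has color $c$. A total coloring is a locally irregular total coloring (TLIR coloring) if for every edge $uv$, with $c$ the color of $uv$, the total $c$-degrees of $u$ and $v$ differ. $\operatorname{tlir}(G)$ is the minimum number of colors in a TLIR coloring of $G$. *)

(* Defs.v *)
From HB Require Import structures.
From mathcomp Require Import all_boot all_order all_algebra.
From mathcomp Require Import all_classical all_reals all_analysis.

Set Implicit Arguments.
Unset Strict Implicit.
Unset Printing Implicit Defensive.

Import Order.TTheory GRing.Theory Num.Theory.
Import numFieldNormedType.Exports.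

Record sgraph := SGraph {
  vertex :> finType;
  adj : rel vertex;
  adj_sym : symmetric adj;
  adj_irrefl : irreflexive adj }.

Definition edge_set (G : sgraph) : {set {set G}} :=
  [set [set p.1; p.2]%SET | p : G * G & adj p.1 p.2]%SET.

Definition edge (G : sgraph) : finType := {e : {set G} | e \in edge_set G}.

Section TotalColoring.
Variables (G : sgraph) (C : finType).

Definition total_coloring : finType := {ffun G + edge G -> C}.

Implicit Types f : total_coloring.

Definition total_degree f (c : C) (v : G) : nat :=
  #|[set e : edge G | (v \in val e) && (f (inr e) == c)]%SET|
  + (f (inl v) == c).

Definition is_tlir f : bool :=
  [forall e : edge G, forall u : G, forall v : G,
     (val e == [set u; v]%SET) ==>
     (total_degree f (f (inr e)) u != total_degree f (f (inr e)) v)].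

End TotalColoring.

Definition tlir_colorable (G : sgraph) (k : nat) : bool :=
  [exists f : total_coloring G 'I_k, is_tlir f].

Lemma edgeP (G : sgraph) (e : edge G) (u v : G) :
  val e = [set u; v]%SET -> u != v.
Proof.
move=> euv; have /imsetP[[x y]] := valP e; rewrite inE /= => xy exy.
have xNy : x != y by apply: contraTneq xy => ->; rewrite adj_irrefl.
have : #|val e| = 2 by rewrite [val e]exy cards2 xNy.
by rewrite euv cards2; case: (u != v).
Qed.

(* Give every vertex its own color, and every edge the color of one of its
   endpoints.                                                                 *)
Lemma tlir_colorable_exists (G : sgraph) : exists k, tlir_colorable G k.
Proof.
exists #|G|; apply/existsP.
have /fin_all_exists[top topP] (e : edge G) : exists x, x \in val e.
  have /imsetP[[x y] _ exy] := valP e.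
  by exists x; rewrite [val e]exy !inE eqxx.
exists [ffun z => match z with inl v => enum_rank v
                             | inr e => enum_rank (top e) end].
apply/forallP => e; apply/forallP => u; apply/forallP => v.
apply/implyP => /eqP euv.
wlog tu : u v euv / top e = u.
  move=> W; have := topP e.
  rewrite euv !inE => /orP[] /eqP; first exact: W.
  by move=> tv; rewrite eq_sym; apply: W => //; rewrite euv finset.setUC.
have uNv := edgeP euv.
rewrite neq_ltn; apply/orP; right.
rewrite /total_degree !ffunE tu eqxx (inj_eq enum_rank_inj) [v == u]eq_sym.
rewrite (negPf uNv) addn0 addn1 ltnS.
apply: subset_leq_card; apply/fintype.subsetP => e'; rewrite !inE !ffunE.
case/andP=> _; rewrite (inj_eq enum_rank_inj) => /eqP te'.
by rewrite te' eqxx andbT -te'; exact: topP.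
Qed.

Definition tlir (G : sgraph) : nat := ex_minn (tlir_colorable_exists G).

Local Open Scope classical_set_scope.
Local Open Scope ring_scope.

(* An edge of G is drawn as an arc, parametrized by [0, 1]; the values of the
   parametrization outside [0, 1] are irrelevant.                             *)
Record plane_drawing (R : realType) (G : sgraph) := PlaneDrawing {
  draw_vertex : G -> R * R;
  draw_edge : edge G -> R -> R * R;
  draw_vertex_inj : injective draw_vertex;
  draw_edge_continuous : forall e, {within `[0, 1], continuous (draw_edge e)};
  draw_edge_inj : forall e, {in `[0, 1] &, injective (draw_edge e)};
  draw_edge_ends : forall e : edge G, exists x y : G,
    [/\ val e = [set x; y]%SET, draw_edge e 0 = draw_vertex x
      & draw_edge e 1 = draw_vertex y];
  draw_edge_vertex : forall (e : edge G) (t : R) (x : G),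
    t \in `]0, 1[ -> draw_edge e t <> draw_vertex x;
  draw_edge_disjoint : forall (e e' : edge G) (t t' : R), e != e' ->
    t \in `]0, 1[ -> t' \in `[0, 1] -> draw_edge e t <> draw_edge e' t' }.

Definition drawing_support (R : realType) (G : sgraph)
    (D : plane_drawing R G) : set (R * R) :=
  range (draw_vertex D)
  `|` \bigcup_(e in [set: edge G]) (draw_edge D e @` `[0, 1]).

Definition is_face (R : realType) (G : sgraph) (D : plane_drawing R G)
    (F : set (R * R)) : Prop :=
  exists2 p, (~` drawing_support D) p
           & F = connected_component (~` drawing_support D) p.

(* The support is compact, so exactly one face is unbounded; a vertex is never
   in a face, so it is on the boundary of a face iff it is in its closure.    *)
Definition outerplanar (R : realType) (G : sgraph) : Prop :=
  exists (D : plane_drawing R G) (F : set (R * R)),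
    [/\ is_face D F, ~ bounded_set F & forall x : G, closure F (draw_vertex D x)].

(* Main.v *)
(* An outerplanar graph is 3-colourable, and every 3-colourable graph has a TLIR
   colouring with 3 colours.

   3-colourable => tlir <= 3.  Let I be a maximal independent set containing a
   colour class and F its complement, so that F induces a bipartite graph with
   sides given by y : F -> bool.  Let s be the set of edges of colour 3 and h the
   set of the other edges, which get colour 1 or 2.  Aim at total degrees in
   colours 1 and 2 of parity (y v, ~~ y v) at v in F and (q v, q v) at v in I, and
   colour an edge by a colour in which the parities of its ends differ: then only
   the edges inside F leave a choice.  A vertex can correct the parity of one of
   its two degrees by its own colour; as the sum of the two degrees is known, this
   suffices if v is in F of even h-degree or in I of odd h-degree, and otherwise v
   gets colour 3 and its parities must be right already.  For v in I this is
   achieved by the choice of q v, and in F by a T-join, provided that every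
   component of F in h has a vertex of even h-degree (or an end vertex of degree
   1, which is recoloured at the end).  The edges of s repair the components of F
   violating this condition: as long as possible a vertex a of I of even degree is
   made the centre of a star with at least two leaves in such components, and for
   each remaining component s contains all the edges at one of its vertices.

   Outerplanar => 3-colourable.  A graph of minimum degree at least 3 contains a
   subdivision of K4, as seen on a longest path.  Adding a point of the outer face
   to a drawn K4 with all its vertices on this face yields a continuous drawing of
   K5 in which edges without common ends are disjoint.  This contradicts the fact
   that independent edges of K5 cross an odd number of times, which is proved for
   chains of points with small steps, counting windings modulo 2. *)

Require Import Defs.
From mathcomp Require Import all_boot.

Set Implicit Arguments.
Unset Strict Implicit.
Unset Printing Implicit Defensive.

(** * Three-colourable graphs *)

Definition nbrs (T : finType) (r : rel T) (v : T) : {set T} := [set w | r v w].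

Definition par (T : finType) (r : rel T) (v : T) : bool := odd #|nbrs r v|.

Lemma par_big (T : finType) (r : rel T) v : par r v = \big[addb/false]_w r v w.
Proof.
rewrite /par /nbrs cardsE -sum1_card big_mkcond /=.
rewrite (big_morph odd oddD (erefl : odd 0 = false)).
by apply: eq_bigr => w _; rewrite unfold_in; case: (r v w).
Qed.

Lemma par_addb (T : finType) (r r' : rel T) v :
  par (fun x y => r x y (+) r' x y) v = par r v (+) par r' v.
Proof. by rewrite !par_big big_split. Qed.

Lemma eq_par (T : finType) (r r' : rel T) v : r v =1 r' v -> par r v = par r' v.
Proof. by move=> e; rewrite !par_big; apply: eq_bigr => w _; rewrite e. Qed.

(** The sum modulo 2 of one path from each vertex of [tau] to [U]: such a path has odd degree at
    most at its ends, and no parity is prescribed at the end in [U]. *)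
Lemma tjoin (T : finType) (h : rel T) (U tau : pred T) :
  symmetric h -> irreflexive h ->
  (forall v, tau v -> exists2 u, U u & connect h v u) ->
  exists J : rel T, [/\ symmetric J, subrel J h &
    forall v, ~~ U v -> par J v = tau v].
Proof.
move=> hC hI htau.
have single v u : U u -> connect h v u ->
    exists J : rel T, [/\ symmetric J, subrel J h &
      forall w, ~~ U w -> par J w = (w == v)].
  move=> Uu /connectP[p]; elim: p v => [|x p IH] v /=.
    move=> _ uv; subst u; exists (fun _ _ => false); split => // w Uw.
    rewrite par_big big1 //; apply/esym/negbTE.
    by apply: contraNneq Uw => ->.
  case/andP=> hvx px lu; have [J [JC Jh Jp]] := IH x px lu.
  (* The first edge of the path is added modulo 2, as the rest may run through it again. *)
  pose E a b := (a == v) && (b == x) || (a == x) && (b == v).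
  exists (fun a b => J a b (+) E a b); split.
  - move=> a b; rewrite JC /E; congr addb.
    by rewrite orbC; congr orb; rewrite andbC.
  - move=> a b; case Jab : (J a b) => /=; first by move=> _; apply: Jh.
    by case/orP=> /andP[/eqP-> /eqP->] //; rewrite hC.
  - move=> w Uw; transitivity (par J w (+) par E w); first exact: par_addb.
    rewrite Jp //.
    have vx : v != x by apply: contraTneq hvx => ->; rewrite hI.
    have nE z : nbrs E z = if z == v then [set x] else if z == x then [set v] else set0.
      apply/setP=> y; rewrite /nbrs inE /E.
      have [->|nv] := eqVneq z v; first by rewrite (negPf vx) orbF inE.
      by have [_|_] := eqVneq z x; rewrite ?inE.
    rewrite /par nE; have [->|nv] := eqVneq w v; first by rewrite (negPf vx) cards1.
    by have [_|_] := eqVneq w x; rewrite ?cards1 ?cards0.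
have /fin_all_exists[K KP] (v : T) : exists J : rel T,
   [/\ symmetric J, subrel J h & forall w, ~~ U w -> par J w = tau v && (w == v)].
  case tv : (tau v); first by have [u Uu cu] := htau _ tv; apply: single cu.
  by exists (fun _ _ => false); split => // w _; rewrite par_big big1.
exists (fun a b => \big[addb/false]_v K v a b); split.
- by move=> a b; apply: eq_bigr => v _; have [-> _ _] := KP v.
- move=> a b; apply: contraTT => nh; rewrite big1 // => v _.
  by apply: contraNF nh; have [_ sub _] := KP v; apply: sub.
- move=> w Uw; rewrite par_big exchange_big /=.
  under eq_bigr => v _ do (rewrite -par_big; have [_ _ ->] := KP v => //).
  rewrite (bigD1 w) //= eqxx andbT big1 ?addbF // => v /negPf vw.
  by rewrite eq_sym vw andbF.
Qed.

Lemma edge_of_adj (G : sgraph) (u v : G) : adj u v ->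
  exists e : edge G, val e = [set u; v].
Proof.
move=> uv; have P : [set u; v] \in edge_set G.
  by apply/imsetP; exists (u, v); rewrite ?inE.
by exists (exist (fun x => x \in edge_set G) _ P).
Qed.

Lemma edge_ends (G : sgraph) (e : edge G) :
  exists p : G * G, adj p.1 p.2 /\ val e = [set p.1; p.2].
Proof. by have /imsetP[p] := valP e; rewrite inE => ap ep; exists p. Qed.

Lemma set2_inj (T : finType) (u v x y : T) : [set u; v] = [set x; y] ->
  (u = x /\ v = y) \/ (u = y /\ v = x).
Proof.
move=> /setP E; have := E u; have := E v; have := E x; have := E y.
rewrite !inE !eqxx ?orbT /= => Ey Ex /esym/orP[]/eqP Ev /esym/orP[]/eqP Eu.
- by move: Ey; rewrite Eu Ev orbb => /eqP ->; left.
- by right.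
- by left.
- by move: Ex; rewrite Eu Ev orbb => /eqP ->; left.
Qed.

(** Symmetry of [ce] makes the choice [P e] of the ends of an edge harmless; [w |-> [set v; w]]
    matches the neighbours of [v] with its edges. *)
Lemma tlir_colorable_rel (G : sgraph) k (cv : G -> 'I_k) (ce : G -> G -> 'I_k) :
  (forall u v, ce u v = ce v u) ->
  (forall u v, adj u v ->
     #|[set w | adj u w && (ce u w == ce u v)]| + (cv u == ce u v) !=
     #|[set w | adj v w && (ce v w == ce u v)]| + (cv v == ce u v)) ->
  tlir_colorable G k.
Proof.
move=> ceC irr; have /fin_all_exists[P PP] := @edge_ends G.
pose f : total_coloring G 'I_k :=
  [ffun z => match z with inl v => cv v | inr e => ce (P e).1 (P e).2 end].
have fE e u v : val e = [set u; v] -> f (inr e) = ce u v.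
  have [_ ->] := PP e; rewrite ffunE => /set2_inj[] [<- <-] //; exact: ceC.
have aE (e : edge G) u v : val e = [set u; v] -> adj u v.
  have [a ->] := PP e => /set2_inj[] [<- <-] //; by rewrite adj_sym.
have degE c v : total_degree f c v =
    #|[set w | adj v w && (ce v w == c)]| + (cv v == c).
  rewrite /total_degree ffunE; congr (_ + _).
  rewrite -(card_imset _ val_inj) -[RHS](@card_in_imset _ _ (fun w => [set v; w])).
    apply: eq_card => X; apply/imsetP/imsetP => -[z].
      rewrite inE => /andP[vz /eqP fz] ->.
      have [w zw] : exists w, val z = [set v; w].
        have [_ E] := PP z; move: vz; rewrite E !inE => /orP[]/eqP->.
          by exists (P z).2.
        by exists (P z).1; rewrite setUC.
      by exists w; rewrite // inE (aE _ _ _ zw) -(fE _ _ _ zw) fz eqxx.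
    rewrite inE => /andP[az /eqP cz] ->; have [e eE] := edge_of_adj az.
    by exists e; rewrite // inE eE !inE eqxx (fE _ _ _ eE) cz eqxx.
  move=> x y; rewrite !inE => /andP[vx _] /andP[vy _] /set2_inj[] [] // v_y xv.
  by rewrite v_y adj_irrefl in vy.
apply/existsP; exists f; apply/forallP => e; apply/forallP => u; apply/forallP => v.
apply/implyP => /eqP euv; rewrite !degE (fE _ _ _ euv).
exact/irr/(aE _ _ _ euv).
Qed.

(** The first step of the [e]-path that is missing from [h] starts in [U]. *)
Lemma connect_dominated (T : finType) (e h : rel T) (U : pred T) (v u : T) :
  (forall x y, e x y -> ~~ h x y -> U x) ->
  U u -> connect e v u -> exists2 w, U w & connect h v w.
Proof.
move=> eh Uu /connectP[p]; elim: p v => [|x p IH] v /=.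
  by move=> _ uv; exists v; rewrite // -uv.
case/andP=> vx px lu; have [hvx|nh] := boolP (h v x); last by exists v; rewrite ?(eh v x).
by have [w Uw xw] := IH x px lu; exists w => //; apply: connect_trans xw; apply: connect1.
Qed.

(** * Colour 3: repairing the components of [F] *)

Section Repair.
Variables (T : finType) (e : rel T) (F : {set T}).
Hypotheses (eC : symmetric e) (eI : irreflexive e).

Let deg v := #|nbrs e v|.
Let eF : rel T := fun x y => [&& e x y, x \in F & y \in F].
(** A T-join may end in [U0]; a component of [F] that misses [U0] has to lose edges to colour 3. *)
Let U0 : pred T := fun u => (u \in F) && (~~ odd (deg u) || (deg u == 1)).
Let bad : pred T := fun v => (v \in F) && ~~ [exists u, connect eF v u && U0 u].

Let eFC : symmetric eF.
Proof. by move=> x y; rewrite /eF eC; congr (_ && _); apply: andbC. Qed.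

Let cFC : connect_sym eF. Proof. exact/sym_connect_sym/eFC. Qed.

Let bad_deg v : bad v -> odd (deg v) && (2 < deg v).
Proof.
case/andP=> vF /existsPn/(_ v); rewrite connect0 /U0 vF /= negb_or negbK => /andP[].
by case: (deg v) => [|[|[|n]]] //= ->.
Qed.

Let badF v : bad v -> v \in F. Proof. by case/andP. Qed.

Let bad_connect v w : connect eF v w -> bad v -> bad w.
Proof.
move=> cvw /andP[vF /existsPn nU].
have wF : w \in F.
  case/connectP: cvw => p; elim/last_ind: p => [_ -> //|p y _].
  by rewrite rcons_path last_rcons => /andP[_ /and3P[_ _ yF]] ->.
apply/andP; split=> //; apply/existsPn => u; apply: contra (nU u).
by case/andP=> cwu ->; rewrite (connect_trans cvw cwu).
Qed.

(* [phi w != w] means that [w] is a leaf of a star of colour 3 with centre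
   [phi w]; every such star has at least two leaves. *)
Definition star_map (phi : {ffun T -> T}) : bool :=
  [forall w, (phi w != w) ==>
     [&& bad w, phi w \notin F, ~~ odd (deg (phi w)), e w (phi w) &
         1 < #|[set x | (x != phi w) && (phi x == phi w)]|]].

Let touched (phi : {ffun T -> T}) v := [exists w, connect eF v w && (phi w != w)].

(** Take the largest number of leaves. Making all of [W] leaves of [a] would increase it, unless [W]
    is empty or the star would have a single leaf. *)
Lemma exists_saturated_star_map : exists2 phi, star_map phi &
  forall a, a \notin F -> ~~ odd (deg a) ->
    let W := [set w | [&& e w a, bad w & ~~ touched phi w]] in
    (#|W| <= 1) /\ ((exists2 w, w != a & phi w = a) -> W = set0).
Proof.
pose sz (phi : {ffun T -> T}) := #|[set w | phi w != w]|.
have id_star : star_map [ffun x => x].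
  by apply/forallP => w; rewrite ffunE eqxx.
pose P n := [exists phi, star_map phi && (sz phi == n)].
have exP : exists n, P n.
  by exists (sz [ffun x => x]); apply/existsP; exists [ffun x => x]; rewrite id_star eqxx.
have leP n : P n -> n <= #|T|.
  by case/existsP=> phi /andP[_ /eqP <-]; apply: max_card.
have [m /existsP[phi /andP[sphi /eqP szm]] mmax] := ex_maxnP exP leP.
exists phi => // a aF da W.
have phia : phi a = a.
  apply/eqP; apply: contraTT (forallP sphi a) => pa.
  by rewrite pa /= /bad (negPf aF).
have Wphi w : w \in W -> phi w = w.
  rewrite inE => /and3P[_ _ /existsPn/(_ w)]; by rewrite connect0 negbK => /eqP.
have Wa w : w \in W -> w != a.
  by rewrite inE => /and3P[ewa _ _]; apply: contraTneq ewa => ->; rewrite eI.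
pose psi : {ffun T -> T} := [ffun x => if x \in W then a else phi x].
have big : 0 < #|W| -> (1 < #|[set x | (x != a) && (psi x == a)]|) -> False.
  move=> W0 ca.
  have spsi : star_map psi.
    apply/forallP => w; apply/implyP; rewrite ffunE; case: ifP => [wW _|wW pw].
      by move: (wW); rewrite inE aF da ca andbT /= => /and3P[-> -> _].
    have /implyP/(_ pw)/and5P[-> -> -> ->] := forallP sphi w.
    rewrite /= => /leq_trans; apply; apply: subset_leq_card; apply/subsetP => x.
    rewrite !inE ffunE => /andP[nx /eqP px]; rewrite nx /=; case: ifP => [xW|_]; last exact/eqP.
    by move: nx; rewrite -px (Wphi _ xW) eqxx.
  have : sz psi <= m by apply: mmax; apply/existsP; exists psi; rewrite spsi eqxx.
  rewrite leqNgt -szm => /negP; apply; apply: proper_card; apply/properP; split.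
    apply/subsetP => x; rewrite !inE ffunE; case: ifP => // xW; by rewrite (Wphi _ xW) eqxx.
  have /card_gt0P[w wW] := W0; exists w; rewrite !inE ?ffunE.
    by rewrite wW eq_sym Wa.
  by rewrite (Wphi _ wW) eqxx.
have Wsub : W \subset [set x | (x != a) && (psi x == a)].
  by apply/subsetP => w wW; rewrite inE Wa //= ffunE wW.
split; first by rewrite leqNgt; apply/negP => W1; apply: big;
  [apply: ltnW | apply: leq_trans W1 (subset_leq_card Wsub)].
case=> w wa pw; apply/eqP; rewrite -cards_eq0 -leqn0 leqNgt; apply/negP => W0.
apply: big => //.
have /implyP := forallP sphi w; rewrite pw eq_sym wa => /(_ isT)/and5P[_ _ _ _ c1].
apply: leq_trans c1 _; apply: subset_leq_card; apply/subsetP => x.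
by rewrite !inE ffunE => /andP[-> px]; case: ifP; rewrite ?eqxx.
Qed.

(* [s] is the set of edges of colour 3; in colour 3 a vertex of [F] (resp.
   outside [F]) is counted iff its degree outside [s] is odd (resp. even). *)
Lemma exists_repair : exists s : rel T,
  let h : rel T := fun x y => e x y && ~~ s x y in
  let hF : rel T := fun x y => [&& h x y, x \in F & y \in F] in
  let t v := #|nbrs s v| + (par h v == (v \in F)) in
  [/\ symmetric s, subrel s e,
      forall x y, s x y -> (x \in F) || (y \in F) -> t x != t y &
      forall v, v \in F -> exists2 u,
        (u \in F) && (~~ par h u || (deg u == 1)) & connect hF v u].
Proof.
have [phi sphi sat] := exists_saturated_star_map.
(* One vertex in each bad component without a leaf; all its edges go to [s]. *)
pose R r := [&& bad r, ~~ touched phi r & root eF r == r].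
pose s : rel T := fun x y => e x y && [|| R x, R y, phi x == y | phi y == x].
have sC : symmetric s.
  by move=> x y; rewrite /s eC orbCA; congr andb; do 2!congr orb; rewrite orbC.
have se : subrel s e by move=> x y /andP[].
exists s => h hF t.
have phiP w : phi w != w -> [&& bad w, phi w \notin F, ~~ odd (deg (phi w)),
    e w (phi w) & 1 < #|[set x | (x != phi w) && (phi x == phi w)]|].
  by move=> pw; have /implyP := forallP sphi w; apply.
have par_h v : par h v = par s v (+) odd (deg v).
  rewrite /deg -[odd _]/(par e v) -par_addb; apply: eq_par => y.
  by rewrite /h; case: (boolP (s v y)) => [/se->|]; rewrite ?andbT ?addbT //= andbT.
have phiF x y : e x y -> phi x = y -> y \notin F /\ bad x.
  move=> exy pxy; have : phi x != x by apply: contraTneq exy; rewrite pxy => ->; rewrite eI.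
  by move/phiP; rewrite pxy => /and5P[].
have Rdeg r : R r -> #|nbrs s r| = deg r.
  by move=> Rr; apply: eq_card => y; rewrite !inE /s Rr andbT.
have touch v w : connect eF v w -> phi w != w -> touched phi v.
  by move=> c p; apply/existsP; exists w; rewrite c p.
have touch_c v w : connect eF v w -> touched phi v -> touched phi w.
  move=> c /existsP[z /andP[cz pz]]; apply: touch pz.
  by apply: connect_trans cz; rewrite cFC.
have eF1 x y : e x y -> x \in F -> y \in F -> connect eF x y.
  by move=> exy xF yF; apply/connect1/and3P.
(* A vertex of [F] on an edge of [s] is a root in [R], or is joined in [s] only to the root of its
   component, or is a leaf joined only to its centre. *)
have sF x y : s x y -> x \in F ->
    [/\ odd (#|nbrs s x|), odd (deg x) & R x \/ #|nbrs s x| = 1].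
  move=> /andP[exy sxy] xF.
  have [Rx|nRx] := boolP (R x).
    by rewrite Rdeg //; have /and3P[/bad_deg/andP[-> _] _ _] := Rx; split=> //; left.
  move: sxy; rewrite (negPf nRx) /= => sxy.
  suff [bx [z ez]] : bad x /\ exists z, nbrs s x = [set z].
    by rewrite ez cards1; have /andP[-> _] := bad_deg bx; split => //; right.
  have pyx : phi y != x.
    by apply: contraL xF => /eqP py; rewrite eC in exy; have [] := phiF _ _ exy py.
  rewrite (negPf pyx) orbF in sxy.
  have [/eqP pxy|npxy] := boolP (phi x == y).
    have [yF bx] := phiF _ _ exy pxy; split=> //; exists y.
    apply/setP => z; rewrite !inE /s (negPf nRx) /=.
    apply/andP/eqP => [[exz /or3P[Rz|/eqP <- //|/eqP pz]]|->]; last by rewrite pxy eqxx orbT.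
      have zF : z \in F by have /and3P[/badF] := Rz.
      have /and3P[_ /negP nt _] := Rz; case: nt.
      apply: (touch _ x); first by rewrite cFC eF1.
      by rewrite pxy; apply: contraTneq exy => ->; rewrite eI.
    by rewrite eC in exz; have [] := phiF _ _ exz pz; rewrite xF.
  rewrite (negPf npxy) orbF in sxy.
  have /and3P[by_ ty /eqP ry] := sxy; have yF := badF by_.
  have cyx : connect eF y x by rewrite cFC eF1.
  have bx := bad_connect cyx by_; split=> //; exists y.
  have tx : ~~ touched phi x by apply: contra ty; apply: touch_c; rewrite cFC.
  apply/setP => z; rewrite !inE /s (negPf nRx) /=.
  apply/andP/eqP => [[exz /or3P[Rz|/eqP pz|/eqP pz]]|->]; last by rewrite sxy.
  - have /and3P[bz _ /eqP rz] := Rz; rewrite -ry -rz; apply/esym/eqP.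
    rewrite root_connect //; apply: connect_trans cyx _.
    by apply: eF1 => //; apply: badF.
  - case/negP: tx; apply: (touch _ x) => //; rewrite pz.
    by apply: contraTneq exz => ->; rewrite eI.
  - by rewrite eC in exz; have [] := phiF _ _ exz pz; rewrite xF.
have sFt x y : s x y -> x \in F -> ~~ par h x /\ (t x = #|nbrs s x|).
  move=> sxy xF; have [ox dx _] := sF _ _ sxy xF.
  by rewrite /t xF par_h dx /par ox /= addn0.
split=> //.
  have R1 z : #|nbrs s z| = 1 -> ~~ R z.
    move=> z1; apply/negP => Rz; move: (z1); rewrite Rdeg // => d1.
    by have /and3P[/bad_deg] := Rz; rewrite d1.
  (* An edge of [s] inside [F] joins a root, of [s]-degree at least 3, to a vertex of [s]-degree
     1. *)
  have key x y : s x y -> x \in F -> t x != t y.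
    move=> sxy xF; have [_ tx] := sFt _ _ sxy xF; have [ox dx cx] := sF _ _ sxy xF.
    have syx : s y x by rewrite sC.
    have [yF|yF] := boolP (y \in F).
      have [_ ty] := sFt _ _ syx yF; rewrite tx ty; have [oy dy cy] := sF _ _ syx yF.
      have exy := se _ _ sxy; have eyx := se _ _ syx.
      have RR z w : R z -> #|nbrs s w| = 1 -> #|nbrs s z| != #|nbrs s w|.
        move=> Rz ->; rewrite Rdeg //; have /and3P[/bad_deg/andP[_ dz] _ _] := Rz.
        by rewrite gtn_eqF // ltnW.
      case: cx cy => [Rx|x1] [Ry|y1].
      - have /and3P[_ _ /eqP rx] := Rx; have /and3P[_ _ /eqP ry] := Ry.
        have xy : x = y by rewrite -rx -ry; apply/eqP; rewrite root_connect // eF1.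
        by rewrite xy eI in exy.
      - exact: RR.
      - by rewrite eq_sym; apply: RR.
      - have /andP[_] := sxy.
        rewrite (negPf (R1 _ x1)) (negPf (R1 _ y1)) /=.
        case/orP=> /eqP; first by case/(phiF _ _ exy) => /negP.
        by case/(phiF _ _ eyx) => /negP.
    rewrite tx /t (negPf yF) par_h /par.
    (* If [deg y] is odd, then [t y] is even, whereas [t x] is odd. *)
    have [dy|dy] := boolP (odd (deg y)).
      apply: contraTneq ox => ->; rewrite addbT oddD.
      by case: (odd _).
    rewrite addbF.
    (* If [deg y] is even, saturation decides: next to a root, [y] has [s]-degree 1 and
       [t y = 1 < t x]; as a centre it has at least two leaves and [t x = 1 < t y]. *)
    have [c1 c2] := sat y yF dy.
    have exy := se _ _ sxy.
    have Rset : forall z, R z -> e z y -> z \in [set w | [&& e w y, bad w & ~~ touched phi w]].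
      by move=> z /and3P[bz tz _] ezy; rewrite inE ezy bz.
    case: cx => [Rx|x1].
      have y1 : #|nbrs s y| <= 1.
        apply: leq_trans c1; apply: subset_leq_card; apply/subsetP => z.
        rewrite [z \in nbrs _ _]inE => /andP[eyz]; have ezy := eyz; rewrite eC in ezy.
        case/or4P=> [Ry|Rz|/eqP pz|/eqP pz].
        + by have /and3P[/badF] := Ry; rewrite (negPf yF).
        + exact: Rset.
        + by have [_ /badF] := phiF _ _ eyz pz; rewrite (negPf yF).
        + have W0 : [set w | [&& e w y, bad w & ~~ touched phi w]] = set0.
            by apply: c2; exists z => //; apply: contraTneq ezy => ->; rewrite eI.
          by have := Rset _ Rx exy; rewrite W0 inE.
      have y0 : 0 < #|nbrs s y| by apply/card_gt0P; exists x; rewrite inE.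
      have -> : #|nbrs s y| = 1 by apply/eqP; rewrite eqn_leq y1 y0.
      rewrite Rdeg //; have /and3P[/bad_deg/andP[_ dz] _ _] := Rx.
      by rewrite /= addn0 gtn_eqF // ltnW.
    have nRx := R1 _ x1.
    have nRy : ~~ R y by apply/negP => /and3P[/badF]; rewrite (negPf yF).
    have nyx : phi y != x.
      by apply/negP => /eqP; rewrite eC in exy; case/(phiF _ _ exy); rewrite xF.
    have /eqP pxy : phi x == y.
      by have /andP[_] := sxy; rewrite (negPf nRx) (negPf nRy) (negPf nyx) orbF.
    have /phiP/and5P[_ _ _ _] : phi x != x.
      by rewrite pxy; apply: contraTneq exy => ->; rewrite eI.
    rewrite x1 pxy => c; rewrite ltn_eqF //; apply: (leq_trans c).
    apply: leq_trans (leq_addr _ _); apply: subset_leq_card; apply/subsetP => z.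
    rewrite !inE /s => /andP[zy /eqP pz]; rewrite pz eqxx !orbT andbT eC.
    have /phiP/and5P[_ _ _] : phi z != z; last by rewrite pz.
    by rewrite pz eq_sym.
  move=> x y sxy /orP[xF|yF]; first exact: key.
  by rewrite eq_sym; apply: key => //; rewrite sC.
move=> v vF.
(* Edges of [F] lost to [s] start at vertices of even [h]-degree, so a path in [eF] suffices. *)
have dom u : (u \in F) && (~~ par h u || (deg u == 1)) -> connect eF v u ->
    exists2 u', (u' \in F) && (~~ par h u' || (deg u' == 1)) & connect hF v u'.
  apply: (@connect_dominated _ eF hF (fun u' => (u' \in F) && (~~ par h u' || (deg u' == 1)))).
  move=> x y /and3P[exy xF yF]; rewrite /hF /h exy xF yF /= andbT negbK => sxy.
  by have [-> _] := sFt _ _ sxy xF.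
have [bv|nbv] := boolP (bad v); last first.
  move: nbv; rewrite /bad vF /= negbK => /existsP[u /andP[cu U0u]].
  apply: (dom u) => //; have /andP[uF ou] := U0u; rewrite uF /=.
  have u0 : #|nbrs s u| = 0.
    apply/eqP; rewrite cards_eq0; apply/eqP/setP => z; rewrite !inE.
    apply/negP => suz; suff : bad u.
      by case/andP=> _ /existsPn/(_ u); rewrite connect0 U0u.
    have /andP[euz] := suz; have ezu := euz; rewrite eC in ezu.
    case/or4P => [/and3P[] //|/and3P[bz _ _]|/eqP pz|/eqP pz].
    - by apply: (bad_connect _ bz); apply: eF1 => //; apply: badF.
    - by have [] := phiF _ _ euz pz.
    - by have [] := phiF _ _ ezu pz; rewrite uF.
  by rewrite par_h /par u0.
have [tv|ntv] := boolP (touched phi v).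
  case/existsP: tv => w /andP[cw pw]; apply: (dom w) => //.
  have bw := bad_connect cw bv; rewrite (badF bw) /=.
  have /and5P[_ _ _ ew _] := phiP _ pw.
  have sw : s w (phi w) by rewrite /s ew eqxx !orbT.
  by have [-> _] := sFt _ _ sw (badF bw).
have cr := connect_root eF v; have br := bad_connect cr bv.
apply: (dom (root eF v)) => //; rewrite (badF br) /= par_h /par Rdeg ?addbb //.
rewrite /R br root_root // eqxx andbT /=.
by apply: contra ntv; apply: touch_c; rewrite cFC.
Qed.

End Repair.

(** * Parity colouring with the other two colours *)

Lemma par_xor_fun (T : finType) (r : rel T) (f : pred T) b v :
  par (fun x z => r x z && (f z != b)) v =
  par (fun x z => r x z && f z) v (+) b && par r v.
Proof.
case: b => /=; last by rewrite addbF; apply: eq_par => z; case: (f z).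
rewrite -par_addb; apply: eq_par => z.
by case: (r v z); case: (f z).
Qed.

Lemma odd_card_split (T : finType) (r c : rel T) v :
  odd #|[set w | r v w && c v w]| (+) odd #|[set w | r v w && ~~ c v w]| = par r v.
Proof.
rewrite -[odd #|_|]/(par (fun x w => r x w && c x w) v).
rewrite -[X in _ (+) X]/(par (fun x w => r x w && ~~ c x w) v).
by rewrite -par_addb; apply: eq_par => w; case: (r v w); case: (c v w).
Qed.

(** Except at vertices of degree 1 in [F], the total degrees in [c0] and [c1] get the parities [q v]
    and [q v (+) (v \in F)]. By the last hypothesis these exceptions have their neighbour outside
    [F], so they can be coloured separately at the end. *)
Lemma tlir_colorable_split (G : sgraph) (F : {set G}) (y : pred G) :
  (forall u v : G, adj u v -> u \in F -> v \in F -> y u != y v) ->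
  (forall u v : G, adj u v -> (u \in F) || (v \in F)) ->
  (forall u v : G, adj u v -> u \in F -> v \in F -> #|nbrs (@adj G) u| != 1) ->
  tlir_colorable G 3.
Proof.
move=> yF indep pend; have aC := @adj_sym G; have aI := @adj_irrefl G.
have [s] := exists_repair F aC aI.
set h : rel G := (fun x z => adj x z && ~~ s x z).
set hF : rel G := (fun x z => [&& h x z, x \in F & z \in F]).
set t := (fun v => #|nbrs s v| + (par h v == (v \in F))).
move=> [sC sub_s st conn].
have hC : symmetric h by move=> x z; rewrite /h aC sC.
have hFC : symmetric hF by move=> x z; rewrite /hF hC; congr (_ && _); apply: andbC.
have hFI : irreflexive hF by move=> x; rewrite /hF /h aI.
pose U v := (v \in F) && (~~ par h v || (#|nbrs (@adj G) v| == 1)).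
(* Outside [F], if the [h]-degree is even, the number of neighbours with [y z != q v] has the same
   parity for both values of [q v]; this parity is chosen. *)
pose q v := if v \in F then y v else par (fun x z => h x z && y z) v.
(* At a vertex of [F], [m] gives the edges leaving [F] that get [c0]; [tau] marks where [J] must
   have odd degree to reach the parity [q v]. *)
pose m : rel G := fun x z => [&& h x z, z \notin F & q z != q x].
pose tau v := [&& v \in F, ~~ U v & q v (+) par m v].
have [|J [JC Jh Jp]] := @tjoin G hF U tau hFC hFI.
  by move=> v /and3P[vF _ _]; have [u Uu cu] := conn v vF; exists u.
pose c0 : 'I_3 := inord 0; pose c1 : 'I_3 := inord 1; pose c2 : 'I_3 := inord 2.
have c01 : (c0 == c1) = false by rewrite -val_eqE /= !inordK.
have c02 : (c0 == c2) = false by rewrite -val_eqE /= !inordK.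
have c12 : (c1 == c2) = false by rewrite -val_eqE /= !inordK.
(* Inside [F] both colours separate the ends and [J] decides; on an edge leaving [F], equal values
   of [q] make the parities in [c1] differ. *)
pose k : rel G := fun u v => if (u \in F) && (v \in F) then J u v else q u != q v.
pose ce u v := if s u v then c2 else if k u v then c0 else c1.
have kC : symmetric k.
  by move=> u v; rewrite /k JC [(v \in F) && _]andbC [q v == _]eq_sym.
have ceC u v : ce u v = ce v u by rewrite /ce sC kC.
pose d (c : 'I_3) v := #|[set w | adj v w && (ce v w == c)]|.
have d0 v : odd (d c0 v) = par (fun x w => h x w && k x w) v.
  rewrite -[odd _]/(par (fun x w => adj x w && (ce x w == c0)) v).
  apply: eq_par => w; rewrite /ce /h -andbA; case: (s v w) => /=; first by rewrite eq_sym c02.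
  by case: (k v w); rewrite ?eqxx // eq_sym c01.
have d1 v : odd (d c1 v) = par (fun x w => h x w && ~~ k x w) v.
  rewrite -[odd _]/(par (fun x w => adj x w && (ce x w == c1)) v).
  apply: eq_par => w; rewrite /ce /h -andbA; case: (s v w) => /=; first by rewrite eq_sym c12.
  by case: (k v w); rewrite ?eqxx // c01.
have d2 v : d c2 v = #|nbrs s v|.
  apply: eq_card => w; rewrite !inE /ce; have [svw|_] := boolP (s v w).
    by rewrite (sub_s _ _ svw) eqxx.
  by case: (k v w); rewrite ?c02 ?c12 andbF.
have d01 v : odd (d c0 v) (+) odd (d c1 v) = par h v.
  by rewrite d0 d1; apply: odd_card_split.
(* A vertex not coloured [c2] adds 1 to the sum of its degrees in [c0] and [c1], which then has the
   parity of [v \in F]; correcting [c0] thus corrects [c1]. *)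
pose cv v := if par h v == (v \in F) then c2 else
             if odd (d c0 v) == q v then c1 else c0.
pose td c v := d c v + (cv v == c).
pose Z v := (v \in F) && (#|nbrs (@adj G) v| == 1).
have fixed v : ~~ Z v -> par h v == (v \in F) -> odd (d c0 v) = q v.
  move=> nZ; have [vF|vF] := boolP (v \in F) => /eqP hv.
    have nU : ~~ U v by move: nZ; rewrite /U /Z vF hv.
    have -> : odd (d c0 v) = par J v (+) par m v.
      rewrite d0 -par_addb; apply: eq_par => w; rewrite /k /m vF /=.
      have [wF|wF] := boolP (w \in F) => /=.
        rewrite andbF addbF; case Jvw : (J v w); last by rewrite andbF.
        by have /and3P[->] := Jh _ _ Jvw.
      case Jvw : (J v w); last by rewrite eq_sym.
      by have /and3P[_ _] := Jh _ _ Jvw; rewrite (negPf wF).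
    by rewrite Jp // /tau vF nU /= -addbA addbb addbF.
  have -> : odd (d c0 v) = par (fun x z => h x z && (y z != q v)) v.
    rewrite d0; apply: eq_par => w; rewrite /k (negPf vF) /=.
    have [hvw|//] := boolP (h v w); have /andP[avw _] := hvw.
    have := indep _ _ avw; rewrite (negPf vF) /= => wF.
    by rewrite /q wF eq_sym.
  by rewrite par_xor_fun hv andbF addbF /q (negPf vF).
have td0 v : ~~ Z v -> odd (td c0 v) = q v.
  move=> nZ; rewrite /td oddD /cv; case: ifP => [/(fixed _ nZ)->|_].
    by rewrite eq_sym c02 addbF.
  by case: ifP; rewrite ?eqxx ?[c1 == _]eq_sym ?c01;
    case: (odd _); case: (q v).
have td1 v : ~~ Z v -> odd (td c1 v) = q v (+) (v \in F).
  move=> nZ; have -> : odd (td c1 v) = odd (d c0 v) (+) par h v (+) (cv v == c1).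
    by rewrite /td oddD oddb -d01 addbA addbb.
  rewrite /cv; case: ifP => [hv|].
    by rewrite (fixed _ nZ hv) (eqP hv) eq_sym c12 addbF.
  by case: ifP; rewrite ?eqxx ?c01;
    case: (odd _); case: (q v); case: (par h v); case: (v \in F).
have td2 v : td c2 v = t v.
  rewrite /td d2 /t /cv; congr (_ + _); case: ifP; first by rewrite eqxx.
  by case: ifP; rewrite ?c12 ?c02.
have irr u v : ~~ Z u -> ~~ Z v -> adj u v -> td (ce u v) u != td (ce u v) v.
  move=> nu nv auv; rewrite /ce; case: ifP => [suv|nsuv].
    by rewrite !td2; apply: st => //; apply: indep.
  have huv : h u v by rewrite /h auv nsuv.
  rewrite /k; have [/andP[uF vF]|FF] := boolP ((u \in F) && (v \in F)).
    have yuv := yF _ _ auv uF vF.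
    case: ifP => _; apply: contraNneq yuv => E.
      by have := td0 _ nu; rewrite E td0 // /q uF vF => ->.
    by have := td1 _ nu; rewrite E td1 // /q uF vF => /addIb ->.
  case: ifP => [quv|/negbFE/eqP quv].
    by apply: contraNneq quv => E; have := td0 _ nu; rewrite E td0 // => ->.
  apply: contraNneq FF => E; have := td1 _ nu; rewrite E td1 // quv => /addbI.
  by have := indep _ _ auv; case: (u \in F); case: (v \in F).
(* In the colour of its only edge such a vertex has total degree 1 or 2, depending on its own
   colour; one of these differs from the value at the neighbour. *)
have /fin_all_exists[cz czP] (v : G) : exists c : 'I_3,
    Z v -> forall w, adj v w -> (1 + (c == ce v w) != td (ce v w) w).
  have [/andP[vF /cards1P[w wE]]|_] := boolP (Z v); last by exists c0.
  have wu x : adj v x -> x = w.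
    by move=> avx; apply/set1P; rewrite -wE inE.
  case: (eqVneq (td (ce v w) w) 1) => [tw|tw].
    by exists (ce v w) => _ x /wu ->; rewrite eqxx tw.
  exists (if ce v w == c0 then c1 else c0) => _ x /wu ->; rewrite eq_sym.
  suff -> : ((if ce v w == c0 then c1 else c0) == ce v w) = false by rewrite addn0.
  by case: ifP => [/eqP->|]; rewrite eq_sym // c01.
pose cw v := if Z v then cz v else cv v.
apply: (@tlir_colorable_rel G 3 cw ce ceC) => u v auv.
have dZ w x : Z w -> adj w x -> #|[set z | adj w z && (ce w z == ce w x)]| = 1.
  move=> /andP[_ /cards1P[z zE]] awx.
  apply/eqP/cards1P; exists x; apply/setP => z'; rewrite !inE.
  have zz z0 : adj w z0 -> z0 = z by move=> a; apply/set1P; rewrite -zE inE.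
  apply/andP/eqP => [[/zz -> _]|->]; last by rewrite eqxx.
  by rewrite -(zz x).
have ZZ w x : adj w x -> Z w -> ~~ Z x.
  move=> awx /andP[wF w1]; apply/negP => /andP[xF _].
  by have := pend _ _ awx wF xF; rewrite w1.
rewrite -!/(d _ _) /cw; have [Zu|nZu] := boolP (Z u).
  rewrite (negPf (ZZ _ _ auv Zu)) /d dZ //; exact: czP.
have [Zv|nZv] := boolP (Z v); last exact: irr.
have avu : adj v u by rewrite aC.
by rewrite /d [in X in _ != X + _]ceC [in X in _ != _ + X]ceC ceC dZ // eq_sym; apply: czP.
Qed.

Theorem tlir_colorable_of_3coloring (G : sgraph) (col : G -> 'I_3) :
  (forall u v : G, adj u v -> col u != col v) -> tlir_colorable G 3.
Proof.
move=> pcol; pose C0 := [set v | col v == ord0].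
pose P (A : {set G}) := [forall x in A, forall z in A, ~~ adj x z].
have P0 : P C0.
  apply/forall_inP => x; rewrite inE => /eqP x0; apply/forall_inP => z.
  by rewrite inE => /eqP z0; apply/negP => /pcol; rewrite x0 z0.
have [A /maxsetP[PA Amax] CA] := maxset_exists P0.
have indep u v : adj u v -> (u \in ~: A) || (v \in ~: A).
  rewrite !inE -negb_and; apply: contraL => /andP[uA vA].
  by have /forall_inP/(_ _ uA)/forall_inP/(_ _ vA) := PA.
apply: (@tlir_colorable_split G (~: A) (fun v => col v == inord 1)) => // u v auv uF vF.
  have nz w : w \in ~: A -> col w != ord0.
    rewrite inE; apply: contra => w0; apply: (subsetP CA); by rewrite inE.
  have := pcol _ _ auv; move: (nz _ uF) (nz _ vF); rewrite -!val_eqE /= inordK //.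
  by case: (col u) => -[|[|[|a]]] ? //=; case: (col v) => -[|[|[|b]]].
(* If the only neighbour of [u] is in [F], then [u] can be added to [A], against maximality. *)
apply/negP => /cards1P[w wE].
have uw x : adj u x -> x = v.
  move=> aux; have /setP E := wE; have := E x; have := E v.
  by rewrite !inE aux auv => /esym/eqP-> /esym/eqP.
have E : u |: A = A.
  apply: Amax; last exact: subsetUr.
  apply/forall_inP => x xA; apply/forall_inP => z zA.
  apply/negP => axz; move: xA zA vF; rewrite !inE.
  case/orP=> [/eqP xu|xA].
    rewrite xu in axz; case/orP=> [/eqP zu|zA]; first by rewrite zu adj_irrefl in axz.
    by rewrite -(uw _ axz) zA.
  case/orP=> [/eqP zu|zA].
    by rewrite zu adj_sym in axz; rewrite -(uw _ axz) xA.
  by have := indep _ _ axz; rewrite !inE xA zA.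
by move: uF; rewrite inE -E setU11.
Qed.

(** * Subdivisions of K4 in graphs of minimum degree 3 *)

From mathcomp Require Import boolp zify.

Definition joined (T : finType) (e : rel T) (X : {set T}) (x y : T) : bool :=
  [&& x \in X, y \in X & connect (fun u v => [&& e u v, u \in X & v \in X]) x y].

Lemma joined_sym (T : finType) (e : rel T) (X : {set T}) x y :
  symmetric e -> joined e X x y -> joined e X y x.
Proof.
move=> eC /and3P[xX yX c]; apply/and3P; split=> //.
rewrite (sym_connect_sym _) // => u v /=.
by rewrite eC; congr (_ && _); apply: andbC.
Qed.

Lemma joined_trans (T : finType) (e : rel T) (X : {set T}) x y z :
  joined e X x y -> joined e X y z -> joined e X x z.
Proof.
move=> /and3P[xX yX c] /and3P[_ zX c']; apply/and3P; split=> //.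
exact: connect_trans c c'.
Qed.

(* The sets are the vertex sets of the six paths of a subdivision of K4. *)
Definition K4_linked (T : finType) (e : rel T) : Prop :=
  exists (a b c d : T) (ab ac ad bc bd cd : {set T}),
    [/\ [/\ joined e ab a b, joined e ac a c & joined e ad a d],
        [/\ joined e bc b c, joined e bd b d & joined e cd c d] &
        [/\ [disjoint ab & cd], [disjoint ac & bd] & [disjoint ad & bc]]].

Section LongestPath.
Variables (T : finType) (e : rel T) (S : {set T}).
Hypotheses (eC : symmetric e) (eI : irreflexive e).

(** [n] counts the edges; values of [v] beyond [n] are irrelevant, so paths are reindexed by plain
    arithmetic. *)
Definition simple_path (n : nat) (v : nat -> T) : Prop :=
  [/\ forall i j, i <= n -> j <= n -> v i = v j -> i = j,
      forall i, i < n -> e (v i) (v i.+1) &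
      forall i, i <= n -> v i \in S].

Lemma simple_path_lt n v : simple_path n v -> n < #|T|.
Proof.
case=> inj _ _; rewrite -[n.+1]card_ord; apply: (@leq_card _ _ (fun i : 'I_n.+1 => v i)).
by move=> i j /inj E; apply/val_inj/E; rewrite -ltnS.
Qed.

Lemma simple_path_cons n v w : simple_path n v -> w \in S -> e (v 0) w ->
  (forall i, i <= n -> v i != w) ->
  simple_path n.+1 (fun i => if i is i'.+1 then v i' else w).
Proof.
move=> [inj step inS] wS vw nw; split=> [[|i] [|j]|[|i]|[|i]] //=.
- by move=> _ jn E; have := nw j jn; rewrite E eqxx.
- by move=> i_n _ E; have := nw i i_n; rewrite E eqxx.
- by move=> ? ? E; rewrite (inj i j).
- by move=> _; rewrite eC.
- exact: step.
- exact: inS.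
Qed.

(** Posa's rotation: the chord replaces the edge from [v i.-1] to [v i], and the initial segment is
    reversed. *)
Lemma simple_path_rot n v i : simple_path n v -> 0 < i <= n -> e (v 0) (v i) ->
  simple_path n (fun t => if t < i then v (i.-1 - t) else v t).
Proof.
move=> [inj step inS] i0n v0i; split=> [s t sn tn|t tn|t tn].
- case: ltnP => si; case: ltnP => ti /inj E; have := E _ _; lia.
- case: ltnP => ti; last by rewrite ltnNge (leqW ti) /=; apply: step.
  case: ltnP => t1i; last first.
    by have [-> ->] : (i.-1 - t = 0 /\ t.+1 = i) by lia.
  rewrite eC; have -> : i.-1 - t = (i.-1 - t.+1).+1 by lia.
  by apply: step; lia.
- by case: ltnP => ti; apply: inS; lia.
Qed.

Let img (n : nat) (v : nat -> T) (P : pred nat) : {set T} :=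
  [set w | [exists t : 'I_n.+1, P t && (v t == w)]].

Let in_img n v (P : pred nat) t : t <= n -> P t -> v t \in img n v P.
Proof.
rewrite -ltnS => tn Pt; rewrite inE; apply/existsP; exists (Ordinal tn).
by rewrite /= Pt eqxx.
Qed.

Let disjoint_img n v (P Q : pred nat) : simple_path n v -> (forall t, P t -> Q t -> False) ->
  [disjoint img n v P & img n v Q].
Proof.
move=> [inj _ _] PQ; rewrite disjoint_subset; apply/subsetP => w.
rewrite inE => /existsP[s /andP[Ps /eqP <-]]; rewrite !inE.
apply/existsPn => t; rewrite negb_and -implybE; apply/implyP => Qt.
apply/eqP => /inj E; apply: (PQ _ Ps); rewrite -E // -ltnS //.
Qed.

Let joined_img n v (P : pred nat) s t : simple_path n v -> s <= t <= n ->
  (forall r, s <= r <= t -> P r) -> joined e (img n v P) (v s) (v t).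
Proof.
move=> [_ step _] /andP[st tn] Pst.
have iP r : s <= r <= t -> v r \in img n v P.
  by move=> rst; apply: in_img; [lia | apply: Pst].
apply/and3P; split; [by apply: iP; lia | by apply: iP; lia |].
set E := (X in connect X); suff H r : s <= r -> r <= t -> connect E (v s) (v r).
  exact: H.
elim: r => [|r IH] sr rt.
  by have -> : s = 0 by lia.
have [->//|nsr] := eqVneq s r.+1.
apply: (connect_trans (IH _ _)); [lia | lia |]; apply: connect1.
by rewrite /E step ?iP //; lia.
Qed.

Let joined_edge n v (P : pred nat) s t : e (v s) (v t) -> s <= n -> t <= n ->
  P s -> P t -> joined e (img n v P) (v s) (v t).
Proof.
move=> est sn tn Ps Pt; apply/and3P; split; rewrite ?in_img //.
by apply: connect1; rewrite est !in_img.
Qed.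

(* Take chords v_0 v_i and v_0 v_j with 2 <= i < j.  Rotating makes v_{i-1} an
   end vertex of a longest path, so it has a third neighbour v_k: if k > i we
   get K4 on v_0, v_{i-1}, v_i, v_{min(j, k)}, and if k < i - 2 then the rotated
   path has chords from its end to the positions i - 1 - k < i. *)
Lemma K4_of_chords n : (forall v, ~ simple_path n.+1 v) ->
  (forall x, x \in S -> 3 <= #|[set y in S | e x y]|) ->
  forall i j v, simple_path n v -> 2 <= i -> i < j -> j <= n ->
  e (v 0) (v i) -> e (v 0) (v j) -> K4_linked e.
Proof.
move=> nmax deg3; elim/ltn_ind => i IH j v pv i2 ij jn e0i e0j.
pose u t := if t < i then v (i.-1 - t) else v t.
have pu : simple_path n u by apply: simple_path_rot => //; lia.
have [inj step inS] := pv.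
have [k [kn ek k1 k2]] : exists k, [/\ k <= n, e (v i.-1) (v k), k <> i & k <> i.-2].
  have : 0 < #|[set y in S | e (v i.-1) y] :\: [set v i; v i.-2]|.
    have c : 3 <= #|[set y in S | e (v i.-1) y]| by apply/deg3/inS; lia.
    rewrite cardsD subn_gt0; apply: leq_trans c; rewrite ltnS.
    apply: leq_trans (subset_leq_card (subsetIr _ _)) _.
    by rewrite cards2; case: (_ != _).
  case/card_gt0P => y; rewrite !inE negb_or => /andP[/andP[yi yi2] /andP[yS ey]].
  have [/existsP[t /eqP ty]|/existsPn ny] := boolP [exists t : 'I_n.+1, v t == y].
    exists t; split; rewrite ?ty //; first by rewrite -ltnS.
      by move=> ti; rewrite -ty ti eqxx in yi.
    by move=> ti; rewrite -ty ti eqxx in yi2.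
  case: (nmax (fun i => if i is i'.+1 then u i' else y)).
  apply: simple_path_cons => //; first by rewrite /u subn0; case: ifP => //; lia.
  move=> t tn; rewrite /u; case: ifP => _.
    have tn' : i.-1 - t < n.+1 by lia.
    exact: ny (Ordinal tn').
  by rewrite -ltnS in tn; apply: ny (Ordinal tn).
have k3 : k <> i.-1 by move=> ki; rewrite ki eI in ek.
have [ki|ki] := ltnP k i; last first.
  (* From [v j] and [v k] the path is followed back to [v m]. *)
  pose m := minn j k.
  exists (v 0), (v i.-1), (v i), (v m).
  exists (img n v (fun t => t < i)), (img n v (fun t => (t == 0) || (t == i))),
    (img n v (fun t => (t == 0) || (m <= t <= j))),
    (img n v (fun t => (t == i.-1) || (t == i))),
    (img n v (fun t => (t == i.-1) || (m <= t <= k))),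
    (img n v (fun t => i <= t <= m)).
  split; split; try by apply: disjoint_img => // t; lia.
  - by apply: joined_img => //; lia.
  - by apply: joined_edge => //; rewrite ?eqxx ?orbT //; lia.
  - apply: (@joined_trans _ _ _ _ (v j)).
      by apply: joined_edge => //; lia.
    by apply: joined_sym => //; apply: joined_img => //; lia.
  - by apply: joined_img => //; lia.
  - apply: (@joined_trans _ _ _ _ (v k)).
      by apply: joined_edge => //; lia.
    by apply: joined_sym => //; apply: joined_img => //; lia.
  - by apply: joined_img => //; lia.
have u0 : u 0 = v i.-1 by rewrite /u subn0; case: ifP => //; lia.
(* The path edge from [v i.-1] to [v i] is the second chord of [u]. *)
apply: (IH (i.-1 - k) _ i u) => //; try lia.
- rewrite u0 /u; case: ifP; last lia.
  by move=> _; have -> : i.-1 - (i.-1 - k) = k by lia.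
- rewrite u0 /u ltnn; have {2}-> : i = i.-1.+1 by lia.
  by apply: step; lia.
Qed.

(** All neighbours of the first vertex of a longest path lie on it, and at least two of them are not
    [v 1]. *)
Lemma K4_of_min_degree3 : S != set0 ->
  (forall x, x \in S -> 3 <= #|[set y in S | e x y]|) -> K4_linked e.
Proof.
move=> /set0Pn[x0 x0S] deg3.
have ex0 : exists n, `[< exists v, simple_path n v >].
  exists 0; apply/asboolP; exists (fun _ => x0); split=> //.
  by move=> i j; rewrite !leqn0 => /eqP-> /eqP->.
have bnd n : `[< exists v, simple_path n v >] -> n <= #|T|.
  by move=> /asboolP[v /simple_path_lt/ltnW].
have [n /asboolP[v pv] nmax] := ex_maxnP ex0 bnd.
have nmax' w : ~ simple_path n.+1 w.
  move=> pw; suff : n < n by rewrite ltnn.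
  by apply: nmax; apply/asboolP; exists w.
have [inj step inS] := pv.
pose I := [set t : 'I_n.+1 | e (v 0) (v t) && (t != 1 :> nat)].
have I2 : 1 < #|I|.
  rewrite -ltnS; apply: leq_trans (deg3 _ (inS 0 _)) _ => //.
  apply: leq_trans (_ : #|[set v 1] :|: [set v (t : 'I__) | t in I]| <= _); last first.
    apply: leq_trans (leq_card_setU _ _) _; rewrite cards1 add1n ltnS.
    exact: leq_imset_card.
  apply: subset_leq_card; apply/subsetP => y; rewrite !inE => /andP[yS ey].
  have [//|ny1] := eqVneq y (v 1); apply/imsetP.
  have [/existsP[t /eqP ty]|/existsPn ny] := boolP [exists t : 'I_n.+1, v t == y].
    exists t => //; rewrite inE ty ey; apply: contraNneq ny1 => t1.
    by rewrite -ty t1.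
  case: (nmax' (fun i => if i is i'.+1 then v i' else y)).
  apply: simple_path_cons => // t; rewrite -ltnS => tn; exact: ny (Ordinal tn).
have [i [j [iI jI ij]]] : exists i j, [/\ i \in I, j \in I & i < j].
  have [i [j [iI jI ij]]] := card_gt1P I2.
  have [lt|lt|E] := ltngtP i j; [by exists i, j | by exists j, i |].
  by rewrite (val_inj E) eqxx in ij.
move: iI jI; rewrite !inE => /andP[ei i1] /andP[ej j1].
have i0 : i != 0 :> nat by apply: contraTneq ei => ->; rewrite eI.
apply: (K4_of_chords nmax' deg3 pv _ ij _ ei ej); first lia.
by rewrite -ltnS.
Qed.

End LongestPath.

(** Greedy colouring: every nonempty induced subgraph has a vertex with at most two neighbours, to
    be coloured last. *)
Lemma colorable3 (G : sgraph) : ~ K4_linked (@adj G) ->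
  exists col : G -> 'I_3, forall u v : G, adj u v -> col u != col v.
Proof.
move=> nK; suff [col colP] : exists col : G -> 'I_3,
    forall u v, u \in [set: G] -> v \in [set: G] -> adj u v -> col u != col v.
  by exists col => u v; apply: colP; rewrite inE.
move: [set: G] => S; have [m] := ubnP #|S|; elim: m S => // m IH S Sm.
have [->|S0] := eqVneq S set0; first by exists (fun _ => ord0) => u v; rewrite inE.
have [x xS dx] : exists2 x, x \in S & #|[set y in S | adj x y]| <= 2.
  apply: contrapT => H; apply: nK.
  apply: (K4_of_min_degree3 (@adj_sym G) (@adj_irrefl G) S0) => x xS.
  by rewrite ltnNge; apply/negP => dx; apply: H; exists x.
have [|col colP] := IH (S :\ x).
  by rewrite (cardsD1 x) xS add1n ltnS in Sm.
have [c cN] : exists c, c \notin [set col y | y in [set y in S | adj x y]].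
  suff /card_gt0P[c] : 0 < #|~: [set col y | y in [set y in S | adj x y]]|.
    by rewrite inE; exists c.
  rewrite cardsCs setCK card_ord subn_gt0.
  exact: leq_ltn_trans (leq_imset_card _ _) _.
have cx y : y \in S -> adj x y -> c != col y.
  move=> yS axy; apply: contraNneq cN => ->; apply: imset_f.
  by rewrite inE yS axy.
exists (fun y => if y == x then c else col y) => u v uS vS auv.
have [E|nux] := eqVneq u x; have [E'|nvx] := eqVneq v x.
- by rewrite E E' adj_irrefl in auv.
- by apply: cx => //; rewrite -E.
- by rewrite eq_sym; apply: cx => //; rewrite adj_sym -E'.
- by apply: colP => //; rewrite !inE ?nux ?nvx.
Qed.

(** * Continuous drawings of K5 *)

From mathcomp Require Import all_order all_algebra.
From mathcomp Require Import all_classical all_reals all_analysis.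
From mathcomp Require Import lra.
From Stdlib Require Import Ring.

Import Order.TTheory GRing.Theory Num.Theory.
Import numFieldNormedType.Exports.

Local Open Scope ring_scope.

(** * Crossing parities of chains with small steps *)

Section Crossing.
Variable R : realType.
Implicit Types (z u v : R * R) (s r : seq (R * R)) (delta eps : R).

Lemma prod_norm_lt z eps :
  (`|z| < eps) = [&& - eps < z.1, z.1 < eps, - eps < z.2 & z.2 < eps].
Proof. by rewrite prod_normE /= gt_max !ltr_norml -andbA. Qed.

(** A half-plane with half of its boundary line: for [z != 0] it contains exactly one of [z] and
    [- z], which avoids any assumption of general position. *)
Definition lexpos z : bool := (0 < z.2) || (z.2 == 0) && (0 < z.1).

(* Whether the step from [z] to [z'] crosses the positive half of the first
   axis, provided that the step is shorter than [z] and [z']. *)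
Definition crosses z z' : bool := (lexpos z (+) lexpos z') && (0 < z.1).

Lemma lexposN z : z != 0 -> lexpos (- z) = ~~ lexpos z.
Proof.
case: z => x y; rewrite /lexpos /= -pair_eqE /= oppr_eq0 !oppr_gt0.
by case: (ltrgtP y 0) => //=; case: (ltrgtP x 0).
Qed.

(** The second coordinates lie on both sides of 0 and are less than [delta] apart, so in the maximum
    norm the first ones are at least [delta] in absolute value and keep their sign. *)
Lemma lexpos_same_side z z' delta :
  `|z - z'| < delta -> delta <= `|z| -> delta <= `|z'| ->
  lexpos z != lexpos z' -> (z.1 != 0) && ((0 < z.1) == (0 < z'.1)).
Proof.
rewrite !leNgt !prod_norm_lt; case: z z' => [x y] [x' y'] /=.
move=> /and4P[x1 x2 y1 y2] nz nz' l.
have ys : (0 <= y /\ y' <= 0) \/ (y <= 0 /\ 0 <= y').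
  by move: l; rewrite /lexpos /=; case: (ltrgtP y 0); case: (ltrgtP y' 0) => //=; auto.
have side (a b : R) : ~~ [&& - delta < a, a < delta, - delta < b & b < delta] ->
    - delta < b -> b < delta -> a <= - delta \/ delta <= a.
  by rewrite !negb_and -!leNgt => /or4P[|||] ? ? ?; [left|right|lra|lra].
have [x3|x3] : x <= - delta \/ delta <= x by apply: side nz _ _; case: ys => -[]; lra.
all: have [x4|x4] : x' <= - delta \/ delta <= x' by apply: side nz' _ _; case: ys => -[]; lra.
all: try (exfalso; lra).
- have x0 : x < 0 by lra.
  have x'0 : x' < 0 by lra.
  by rewrite lt_eqF // !ltNge (ltW x0) (ltW x'0).
- have x0 : 0 < x by lra.
  have x'0 : 0 < x' by lra.
  by rewrite gt_eqF // x0 x'0.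
Qed.

(** A small quadrilateral far from the origin crosses a ray evenly often. Its diagonals may reach
    [2 * eps], whence the first hypothesis. *)
Lemma crosses_square u u' v v' eps delta : 2 * eps < delta ->
  `|u - u'| <= eps -> `|v - v'| <= eps ->
  delta <= `|u - v| -> delta <= `|u - v'| -> delta <= `|u' - v| -> delta <= `|u' - v'| ->
  crosses (u - v) (u' - v) (+) crosses (u' - v) (u' - v') =
  crosses (u - v) (u - v') (+) crosses (u - v') (u' - v').
Proof.
move=> ed uu vv d1 d2 d3 d4.
have close (a a' b b' : R * R) : `|a - a'| <= eps -> `|b - b'| <= eps -> `|a - b - (a' - b')| < delta.
  move=> aa bb; have -> : a - b - (a' - b') = (a - a') + (b' - b).
    by rewrite opprB [b' - a']addrC addrACA [- b + b']addrC.
  apply: le_lt_trans (ler_normD _ _) _; rewrite [X in _ + X]distrC.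
  by apply: le_lt_trans (lerD aa bb) _; rewrite -mulr2n -mulr_natl.
have e0 : 0 <= eps := le_trans (normr_ge0 _) uu.
have refl (a : R * R) : `|a - a| <= eps by rewrite subrr normr0.
have same z z' : `|z - z'| < delta -> delta <= `|z| -> delta <= `|z'| ->
    (lexpos z (+) lexpos z') ==> ((0 < z.1) == (0 < z'.1)).
  move=> dz z1 z2; apply/implyP; rewrite -negb_eqb => l.
  by have /andP[] := lexpos_same_side dz z1 z2 l.
have H1 := same (u - v) (u' - v) (close _ _ _ _ uu (refl _)) d1 d3.
have H2 := same (u - v) (u - v') (close _ _ _ _ (refl _) vv) d1 d2.
have H3 := same (u' - v) (u' - v') (close _ _ _ _ (refl _) vv) d3 d4.
have H4 := same (u - v') (u' - v') (close _ _ _ _ uu (refl _)) d2 d4.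
have H5 := same (u - v) (u' - v') (close _ _ _ _ uu vv) d1 d4.
rewrite distrC in vv.
have H6 := same (u - v') (u' - v) (close _ _ _ _ uu vv) d2 d3.
move: H1 H2 H3 H4 H5 H6; rewrite /crosses.
by do 4!case: (lexpos _); do 4!case: (0 < _).
Qed.

(** Negation exchanges the two halves of the axis, and the crossings of both add up to the change of
    [lexpos]. *)
Lemma crossesN u u' v eps delta : eps < delta ->
  `|u - u'| <= eps -> delta <= `|u - v| -> delta <= `|u' - v| ->
  crosses (v - u) (v - u') = crosses (u - v) (u' - v) (+) lexpos (u - v) (+) lexpos (u' - v).
Proof.
move=> ed uu d1 d2; have e0 : 0 <= eps := le_trans (normr_ge0 _) uu.
have nz z : delta <= `|z| -> z != 0.
  by move=> dz; rewrite -normr_gt0; apply: lt_le_trans dz; apply: le_lt_trans ed.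
rewrite -[v - u]opprB -[v - u']opprB /crosses !lexposN ?nz //.
have duu : `|u - v - (u' - v)| < delta.
  by rewrite opprB addrA subrK; apply: le_lt_trans ed.
have := lexpos_same_side duu d1 d2.
rewrite /= oppr_gt0; case: (ltrgtP (u - v).1 0) => // _;
  do 2!case: (lexpos _); by move=> //= /(_ isT).
Qed.

(** For a closed chain with small steps and [f u = u - v], this is the winding number around [v]
    modulo 2. *)
Fixpoint winding (f : R * R -> R * R) z s : bool :=
  if s is x :: s' then crosses (f z) (f x) (+) winding f x s' else false.

Definition chain eps : R * R -> seq (R * R) -> bool := path (fun u v => `|u - v| <= eps).

Lemma winding_step z s v v' eps delta : 2 * eps < delta -> `|v - v'| <= eps ->
  chain eps z s ->
  {in z :: s, forall u, delta <= `|u - v| /\ delta <= `|u - v'|} ->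
  winding (fun u => u - v) z s (+) crosses (last z s - v) (last z s - v') =
  crosses (z - v) (z - v') (+) winding (fun u => u - v') z s.
Proof.
move=> ed vv; elim: s z => [|x s IH] z /=; first by rewrite addbF.
case/andP=> zx cs far; have farx : {in x :: s, forall u, delta <= `|u - v| /\ delta <= `|u - v'|}.
  by move=> u us; apply: far; rewrite inE us orbT.
have [f1 f2] := far z (mem_head _ _); have [f3 f4] := farx x (mem_head _ _).
by rewrite -addbA IH // addbA (crosses_square ed) // addbA.
Qed.

(** The differences [x - y] over the grid of two distant chains avoid the origin; gluing its small
    squares compares the two ways along the boundary. *)
Lemma winding_rectangle u s v r eps delta : 2 * eps < delta ->
  chain eps u s -> chain eps v r ->
  {in u :: s & v :: r, forall x y, delta <= `|x - y|} ->
  winding (fun x => x - v) u s (+) winding (fun y => last u s - y) v r =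
  winding (fun y => u - y) v r (+) winding (fun x => x - last v r) u s.
Proof.
move=> ed cs; elim: r v => [|y r IH] v /=; first by rewrite addbF.
case/andP=> vy cr far.
have far' : {in u :: s & y :: r, forall x y, delta <= `|x - y|}.
  by move=> a b aS bS; apply: far; rewrite // inE bS orbT.
rewrite addbA (winding_step ed vy) //; first by rewrite -addbA IH // addbA.
by move=> a aS; split; apply: far; rewrite // !inE eqxx ?orbT.
Qed.

Lemma windingN v u s eps delta : eps < delta -> chain eps u s ->
  {in u :: s, forall x, delta <= `|x - v|} ->
  winding (fun x => v - x) u s =
  winding (fun x => x - v) u s (+) lexpos (u - v) (+) lexpos (last u s - v).
Proof.
move=> ed; elim: s u => [|x s IH] u /=; first by rewrite addbb.
case/andP=> ux cs far.
have far' : {in x :: s, forall x, delta <= `|x - v|}.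
  by move=> a aS; apply: far; rewrite inE aS orbT.
rewrite IH // (@crossesN _ _ _ eps delta) //; first last.
- by apply: far'; rewrite mem_head.
- by apply: far; rewrite mem_head.
by do 2!case: (crosses _ _); case: (winding _ _ _); do 3!case: (lexpos _).
Qed.

(* The number of pairs of crossing independent edges of a drawing of K5 is odd;
   here it is expressed by winding numbers modulo 2: the terms [w] of the 15
   rectangles cancel, and the terms [L] add up to the parity of the number of
   4-subsets. *)
Lemma no_K5_chains (P : nat -> R * R) (C : nat -> nat -> seq (R * R)) eps delta :
  0 < delta -> 2 * eps < delta ->
  (forall i j, (i < j < 5)%N -> chain eps (P i) (C i j) /\ last (P i) (C i j) = P j) ->
  (forall i j k l, (i < j < 5)%N -> (k < l < 5)%N -> uniq [:: i; j; k; l] ->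
     {in P i :: C i j & P k :: C k l, forall x y, delta <= `|x - y|}) -> False.
Proof.
move=> d0 ed2 CP far; have ed : eps < delta by lra.
pose w i j k := winding (fun x => x - P k) (P i) (C i j).
(* Written by cases so that [L i j] and [L j i] are complementary by definition for [i < j]. *)
pose L i j := if (j < i)%N then lexpos (P i - P j) else xorb true (lexpos (P j - P i)).
have LE i j : delta <= `|P i - P j| -> lexpos (P i - P j) = L i j.
  move=> dij; rewrite /L; case: ifP => // _; rewrite -[P i - P j]opprB lexposN //.
  by rewrite -normr_gt0 distrC; apply: lt_le_trans dij.
pose Q i j k l :=
  xorb (xorb (xorb (w i j k) (w i j l)) (xorb (w k l i) (w k l j)))
       (xorb (xorb (L k i) (L l i)) (xorb (L k j) (L l j))).
have quad i j k l : (i < j < 5)%N -> (k < l < 5)%N -> uniq [:: i; j; k; l] ->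
    Q i j k l = false.
  move=> ij kl u; have [cij lij] := CP _ _ ij; have [ckl lkl] := CP _ _ kl.
  have fr := far _ _ _ _ ij kl u.
  have iI : P i \in P i :: C i j := mem_head _ _.
  have kK : P k \in P k :: C k l := mem_head _ _.
  have jI : P j \in P i :: C i j by rewrite -lij mem_last.
  have lK : P l \in P k :: C k l by rewrite -lkl mem_last.
  rewrite /Q; have := winding_rectangle ed2 cij ckl fr; rewrite lij lkl.
  rewrite !(windingN ed ckl); first last.
  - by move=> x xK; rewrite distrC; apply: fr.
  - by move=> x xK; rewrite distrC; apply: fr.
  rewrite lkl !LE 1?distrC ?fr // -!/(w _ _ _).
  by do 4!case: (w _ _ _); do 4!case: (L _ _).
have : xorb (Q 0 1 2 3)
  (xorb (Q 0 1 2 4)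
  (xorb (Q 0 1 3 4)
  (xorb (Q 0 2 1 3)
  (xorb (Q 0 2 1 4)
  (xorb (Q 0 2 3 4)
  (xorb (Q 0 3 1 2)
  (xorb (Q 0 3 1 4)
  (xorb (Q 0 3 2 4)
  (xorb (Q 0 4 1 2)
  (xorb (Q 0 4 1 3)
  (xorb (Q 0 4 2 3)
  (xorb (Q 1 2 3 4)
  (xorb (Q 1 3 2 4)
  (xorb (Q 1 4 2 3) false)))))))))))))) = true.
  have LN i j : (i < j)%N -> L i j = xorb true (L j i).
    by move=> ij; rewrite /L ij ltnNge (ltnW ij).
  by rewrite /Q !(LN 1 2, LN 1 3, LN 1 4, LN 2 3, LN 2 4, LN 3 4) //; ring.
by rewrite !quad.
Qed.

End Crossing.

Local Open Scope classical_set_scope.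

(** * Chains in connected sets and distances of compact sets *)

Lemma exists_common_lower_bound (R : realType) (I : finType) (Q : I -> R -> Prop) :
  (forall i x y, y <= x -> Q i x -> Q i y) ->
  (forall i, exists2 x, 0 < x & Q i x) -> exists2 x, 0 < x & forall i, Q i x.
Proof.
move=> Qle Qex; have /fin_all_exists2[d d0 Qd] := Qex.
exists (\big[Order.min/1]_i d i); first by apply: lt_bigmin.
by move=> i; apply: Qle (Qd i); apply: bigmin_le_cond.
Qed.

(** The class of [x] is both open and closed in [A]. *)
Lemma connected_equiv (T : topologicalType) (A : set T) (r : T -> T -> Prop) :
  connected A -> (forall x y, A x -> A y -> r x y -> r y x) ->
  (forall x y z, A x -> A y -> A z -> r x y -> r y z -> r x z) ->
  (forall x, A x -> exists2 N, nbhs x N & forall y, A y -> N y -> r x y) ->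
  forall x y, A x -> A y -> r x y.
Proof.
move=> Aconn rC rT rN x y Ax Ay.
have rr z : A z -> r z z.
  by move=> Az; have [N Nz Nr] := rN z Az; apply: Nr => //; apply: nbhs_singleton.
have /choice[N NP] z : exists N, A z -> nbhs z N /\ forall y, A y -> N y -> r z y.
  have [Az|nAz] := pselect (A z); last by exists setT.
  by have [N Nz Nr] := rN z Az; exists N.
suff E : A `&` [set z | r x z] = A.
  have : A y by []; by rewrite -{1}E => -[].
apply: Aconn; first by exists x; split=> //; apply: rr.
- exists (\bigcup_(z in A `&` [set z | r x z]) (N z)°).
    by apply: bigcup_open => z _; apply: open_interior.
  apply/seteqP; split=> z [Az].
    move=> xz; split=> //; exists z => //.
    by have [] := NP z Az.
  move=> [w [Aw xw] /interior_subset Nz]; split=> //.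
  by apply: (rT x w z) => //; have [_] := NP w Aw; apply.
- exists (~` \bigcup_(z in A `&` [set z | ~ r x z]) (N z)°).
    apply: open_closedC; apply: bigcup_open => z _; exact: open_interior.
  apply/seteqP; split=> z [Az].
    move=> xz; split=> //; move=> [w [Aw nxw] /interior_subset Nz]; apply: nxw.
    apply: (rT x z w) => //; apply: rC => //.
    by have [_] := NP w Aw; apply.
  move=> nz; split=> //; apply: contrapT => nxz; apply: nz; exists z => //.
  by have [] := NP z Az.
Qed.

Section Linked.
Variable R : realType.
Implicit Types (x y z c : R * R) (A K : set (R * R)).

Definition chained (eps : R) K x y : Prop :=
  exists s, [/\ chain eps x s, last x s = y & forall z, z \in x :: s -> K z].

Lemma chained_trans eps K x y z :
  chained eps K x y -> chained eps K y z -> chained eps K x z.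
Proof.
move=> [s [cs ls Ks]] [r [cr lr Kr]].
exists (s ++ r); split; first by rewrite /chain cat_path -/(chain _ _ _) cs ls.
  by rewrite last_cat ls.
move=> w; rewrite -cat_cons mem_cat => /orP[/Ks //|wr].
by apply: Kr; rewrite inE wr orbT.
Qed.

Lemma chained_sym eps K x y : chained eps K x y -> chained eps K y x.
Proof.
move=> [s [cs <- Ks]]; exists (rev (belast x s)); split.
- by rewrite /chain rev_path; apply: sub_path cs => u v /=; rewrite distrC.
- by case: s {cs Ks} => //= z s; rewrite rev_cons last_rcons.
- move=> z zs; apply: Ks; rewrite lastI mem_rcons inE.
  by move: zs; rewrite inE mem_rev.
Qed.

(** A substitute for arcs that is available in every connected set, in particular in a face. *)
Definition linked K x y : Prop := forall eps : R, 0 < eps -> chained eps K x y.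

Lemma linked_sub K K' x y : K `<=` K' -> linked K x y -> linked K' x y.
Proof.
by move=> KK l eps /l[s [cs ls Ks]]; exists s; split=> // z /Ks/KK.
Qed.

Lemma linked_trans K x y z : linked K x y -> linked K y z -> linked K x z.
Proof. by move=> l l' eps e0; apply: chained_trans (l _ e0) (l' _ e0). Qed.

Lemma linked_sym K x y : linked K x y -> linked K y x.
Proof. by move=> l eps /l/chained_sym. Qed.

Lemma linked_connected A x y : connected A -> A x -> A y -> linked A x y.
Proof.
move=> Aconn Ax Ay eps e0; move: x y Ax Ay.
apply: (@connected_equiv _ A (chained eps A) Aconn).
- by move=> x y _ _; apply: chained_sym.
- by move=> x y z _ _ _; apply: chained_trans.
move=> x Ax; exists (ball x eps); first exact: nbhsx_ballx.
move=> y Ay; rewrite -ball_normE /= => xy; exists [:: y]; split=> //=.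
  by rewrite andbT ltW.
by move=> z; rewrite !inE => /orP[]/eqP->.
Qed.

Lemma linked_path (f : R -> R * R) : {within `[0, 1], continuous f} ->
  linked (f @` `[0, 1]) (f 0) (f 1).
Proof.
move=> fc; apply: linked_connected; last first.
- by exists 1; rewrite //= in_itv /= ler01 lexx.
- by exists 0; rewrite //= in_itv /= ler01 lexx.
- by apply: connected_continuous_connected fc; apply: segment_connected.
Qed.

Lemma linked_ball c (eta : R) x y : `|x - c| <= eta -> `|y - c| <= eta ->
  linked [set z | `|z - c| <= eta] x y.
Proof.
move=> xc yc; pose f (t : R) := x + t *: (y - x).
have f0 : f 0 = x by rewrite /f scale0r addr0.
have f1 : f 1 = y by rewrite /f scale1r addrC subrK.
rewrite -[x in linked _ x _]f0 -[y in linked _ _ y]f1; apply: linked_sub (linked_path _).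
  move=> _ [t tI <-] /=; move: tI; rewrite /= in_itv /= => /andP[t0 t1]. 
  have -> : f t - c = (1 - t) *: (x - c) + t *: (y - c).
    have -> : f t - c = (x - c) + t *: (y - x) by rewrite /f addrAC.
    have -> : y - x = (y - c) - (x - c) by rewrite opprB addrA subrK.
    by rewrite scalerBr scalerBl scale1r addrA addrAC.
  apply: le_trans (ler_normD _ _) _; rewrite !normrZ !ger0_norm ?subr_ge0 //.
  have -> : eta = (1 - t) * eta + t * eta by rewrite -mulrDl subrK mul1r.
  by apply: lerD; apply: ler_wpM2l; rewrite ?subr_ge0.
apply: continuous_subspaceT => t; apply: cvgD; first exact: cvg_cst.
by apply: cvgZr_tmp; apply: cvg_id.
Qed.

Definition far_apart K K' : Prop :=
  exists2 delta : R, 0 < delta & forall u v, K u -> K' v -> delta <= `|u - v|.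

(** The distances form a compact, hence closed, set that misses 0. *)
Lemma compact_far_apart K K' : compact K -> compact K' -> K `&` K' = set0 ->
  far_apart K K'.
Proof.
move=> cK cK' KK'.
pose f (w : (R * R) * (R * R)) : R := `|w.1 - w.2|.
have fc : continuous f.
  move=> w; apply: cvg_norm; apply: cvgB; [exact: cvg_fst | exact: cvg_snd].
have : compact (f @` (K `*` K')).
  by apply: continuous_compact; [apply: continuous_subspaceT | apply: compact_setX].
move=> /(compact_closed (@norm_hausdorff _ _)) /closed_openC/(_ 0) [].
  move=> [[u v] [/= Ku K'v] /eqP]; rewrite normr_eq0 subr_eq0 => /eqP /= uv.
  by have : (K `&` K') u by [split; rewrite // uv]; rewrite KK'.
move=> d /= d0 dP; exists d => // u v Ku K'v; rewrite leNgt; apply/negP => uvd.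
apply: (dP `|u - v|); last by exists (u, v).
by rewrite /= sub0r normrN normr_id.
Qed.

(** Finitely many pairs of sets have a common distance [delta]; steps of [delta / 3] are then small
    enough. *)
Lemma no_K5_linked (P : nat -> R * R) (K : nat -> nat -> set (R * R)) :
  (forall i j, (i < j < 5)%N -> linked (K i j) (P i) (P j)) ->
  (forall i j k l, (i < j < 5)%N -> (k < l < 5)%N -> uniq [:: i; j; k; l] ->
     far_apart (K i j) (K k l)) -> False.
Proof.
move=> lK fK.
pose Q (q : 'I_5 * 'I_5 * 'I_5 * 'I_5) (d : R) :=
  let: (i, j, k, l) := q in (i < j)%N -> (k < l)%N -> uniq [:: i : nat; j : nat; k : nat; l : nat] ->
  forall u v, K i j u -> K k l v -> d <= `|u - v|.
have [delta d0 dP] : exists2 d, 0 < d & forall q, Q q d.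
  apply: exists_common_lower_bound.
    by move=> [[[i j] k] l] x y yx Qx ij kl u a b Ka Kb; apply: le_trans yx _; apply: Qx.
  move=> [[[i j] k] l]; rewrite /Q.
  have [/and3P[ij kl u]|n] := boolP [&& (i < j)%N, (k < l)%N & uniq [:: i : nat; j : nat; k : nat; l : nat]].
    have [||//|d d0 dP] := fK i j k l; rewrite ?ij ?kl ?ltn_ord //.
    by exists d => // _ _ _.
  by exists 1 => // ij kl u; case/negP: n; rewrite ij kl u.
have /choice[C CP] (q : nat * nat) : exists s, (q.1 < q.2 < 5)%N ->
    [/\ chain (delta / 3) (P q.1) s, last (P q.1) s = P q.2 &
        forall z, z \in P q.1 :: s -> K q.1 q.2 z].
  have [qq|nq] := boolP (q.1 < q.2 < 5)%N; last by exists [::].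
  by have [|s sP] := lK _ _ qq (delta / 3); [lra | exists s].
apply: (@no_K5_chains R P (fun i j => C (i, j)) (delta / 3) delta) => //; try lra.
  by move=> i j ij; have [] := CP (i, j) ij.
move=> i j k l ij kl u x y xC yC.
have [/= _ _ Kx] := CP (i, j) ij; have [/= _ _ Ky] := CP (k, l) kl.
have [/andP[ij' j5] /andP[kl' l5]] := (ij, kl).
have i5 := ltn_trans ij' j5; have k5 := ltn_trans kl' l5.
by apply: (dP (Ordinal i5, Ordinal j5, Ordinal k5, Ordinal l5)); rewrite //=; [apply: Kx | apply: Ky].
Qed.

End Linked.

(** * Outerplanar graphs *)

Lemma far_apart_sym (R : realType) (K K' : set (R * R)) :
  far_apart K K' -> far_apart K' K.
Proof. by move=> [d d0 dP]; exists d => // u v Ku Kv; rewrite distrC; apply: dP. Qed.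

Lemma far_apart_bigcup (R : realType) (I : finType) (P : pred I)
    (K : set (R * R)) (L : I -> set (R * R)) :
  (forall i, P i -> far_apart K (L i)) -> far_apart K (\bigcup_(i in [set i | P i]) L i).
Proof.
move=> far; pose Q i (d : R) := P i -> forall u v, K u -> L i v -> d <= `|u - v|.
have [d d0 dP] : exists2 d, 0 < d & forall i, Q i d.
  apply: exists_common_lower_bound => [i x y yx Qx Pi u v Ku Lv|i].
    by apply: le_trans yx _; apply: Qx.
  have [/far[d d0 dP]|nP] := boolP (P i); first by exists d => // _.
  by exists 1 => // Pi; rewrite Pi in nP.
by exists d => // u v Ku [i /= Pi Lv]; apply: (dP i).
Qed.

(** * Subdrawings, faces and the fifth vertex of K5 *)

Section Drawing.
Variables (R : realType) (G : sgraph) (D : plane_drawing R G).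

Definition piece_vertices (i : G + edge G) : {set G} :=
  match i with inl x => [set x]%SET | inr e => val e end.

Definition piece (i : G + edge G) : set (R * R) :=
  match i with
  | inl x => [set draw_vertex D x]
  | inr e => draw_edge D e @` `[0, 1]
  end.

(** The drawing of the subgraph induced by [X], as a finite union of compact pieces. *)
Definition subdrawing (X : {set G}) : set (R * R) :=
  \bigcup_(i in [set i | piece_vertices i \subset X]) piece i.

Lemma drawing_supportE : drawing_support D = subdrawing [set: G]%SET.
Proof.
apply/seteqP; split=> z.
  case=> [[x _ <-]|[e _ ez]]; first by exists (inl x); rewrite /= ?finset.subsetT.
  by exists (inr e); rewrite /= ?finset.subsetT.
by case=> [[x|e]] _ /= zi; [left; exists x | right; exists e].
Qed.

Lemma subdrawing_sub (X X' : {set G}) : X \subset X' -> subdrawing X `<=` subdrawing X'.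
Proof.
by move=> XX z [i /= iX zi]; exists i => //=; apply: fintype.subset_trans XX.
Qed.

Lemma draw_edge_eq_vertex (e : edge G) (t : R) (x : G) : t \in `[0, 1]%R ->
  draw_edge D e t = draw_vertex D x -> x \in val e.
Proof.
move=> t01 etx; have [y [z [eyz e0 e1]]] := draw_edge_ends D e.
have [t0|t0] := eqVneq t 0.
  by rewrite t0 e0 in etx; rewrite -(draw_vertex_inj etx) eyz !inE eqxx.
have [t1|t1] := eqVneq t 1.
  by rewrite t1 e1 in etx; rewrite -(draw_vertex_inj etx) eyz !inE eqxx orbT.
have ti : t \in `]0, 1[%R.
  move: t01; rewrite !in_itv /= => /andP[t0' t1'].
  by rewrite !lt_neqAle t0' t1' t1 eq_sym t0.
by case: (draw_edge_vertex ti etx).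
Qed.

Lemma draw_edges_meet (e e' : edge G) (t t' : R) :
  t \in `[0, 1]%R -> t' \in `[0, 1]%R ->
  draw_edge D e t = draw_edge D e' t' -> ~~ [disjoint val e & val e']%B.
Proof.
move=> t01 t'01 E; have [<-|ne] := eqVneq e e'.
  have [y [z [eyz _ _]]] := draw_edge_ends D e.
  by apply/pred0Pn; exists y; rewrite /= eyz !inE eqxx.
have [ti|nti] := boolP (t \in `]0, 1[%R).
  by case: (draw_edge_disjoint ne ti t'01 E).
have [y [z [eyz e0 e1]]] := draw_edge_ends D e.
have [x xe ex] : exists2 x, x \in val e & draw_edge D e t = draw_vertex D x.
  move: t01 nti; rewrite !in_itv /= => /andP[t0 t1].
  rewrite negb_and -!leNgt => /orP[t0'|t1'].
    have -> : t = 0 by apply/eqP; rewrite eq_le t0 t0'.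
    by exists y; rewrite ?eyz ?inE ?eqxx.
  have -> : t = 1 by apply/eqP; rewrite eq_le t1 t1'.
  by exists z; rewrite ?eyz ?inE ?eqxx ?orbT.
apply/pred0Pn; exists x; rewrite /= xe /=.
by apply: (draw_edge_eq_vertex t'01); rewrite -E.
Qed.

Lemma compact_piece i : compact (piece i).
Proof.
case: i => [x|e]; first exact: compact_set1.
by apply: continuous_compact; [apply: draw_edge_continuous | apply: segment_compact].
Qed.

Lemma disjoint_pieces i j : [disjoint piece_vertices i & piece_vertices j]%B ->
  piece i `&` piece j = set0.
Proof.
move=> dij; apply/seteqP; split=> // z [].
case: i j dij => [x|e] [y|e'] /= dij.
- move=> -> /draw_vertex_inj xy; have /pred0P/(_ x) := dij.
  by rewrite /= !inE xy eqxx.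
- move=> -> [t t01 /(draw_edge_eq_vertex t01) xe].
  by have /pred0P/(_ x) := dij; rewrite /= !inE eqxx xe.
- move=> [t t01 <-] /(draw_edge_eq_vertex t01) ye.
  by have /pred0P/(_ y) := dij; rewrite /= !inE eqxx ye.
- move=> [t t01 <-] [t' t'01 /esym E].
  by have := draw_edges_meet t01 t'01 E; rewrite dij.
Qed.

Lemma far_apart_subdrawing (X Y : {set G}) : [disjoint X & Y]%B ->
  far_apart (subdrawing X) (subdrawing Y).
Proof.
move=> XY; apply: far_apart_bigcup => j jY; apply: far_apart_sym.
apply: far_apart_bigcup => i iX; apply: compact_far_apart; [exact: compact_piece..|].
apply: disjoint_pieces; rewrite disjoint_sym.
exact: (disjointWl iX (disjointWr jY XY)).
Qed.

Lemma far_apart_support z : (~` drawing_support D) z ->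
  far_apart [set z] (drawing_support D).
Proof.
rewrite drawing_supportE => nz; apply: far_apart_bigcup => i iX.
apply: compact_far_apart; [exact: compact_set1 | exact: compact_piece |].
apply/seteqP; split=> // w [-> wi]; apply: nz; by exists i.
Qed.

Lemma linked_subdrawing (X : {set G}) (x y : G) : joined (@adj G) X x y ->
  linked (subdrawing X) (draw_vertex D x) (draw_vertex D y).
Proof.
case/and3P=> xX _ /connectP[p]; elim: p x xX => [|z p IH] x xX /=.
  move=> _ -> eps _; exists [::]; split=> // w; rewrite inE => /eqP ->.
  by exists (inl x); rewrite /= ?finset.sub1set.
case/andP=> /and3P[xz _ zX] pz lz; apply: linked_trans (IH z zX pz lz).
have [e exz] := edge_of_adj xz.
have le : linked (subdrawing X) (draw_edge D e 0) (draw_edge D e 1).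
  apply: linked_sub (linked_path (@draw_edge_continuous _ _ D e)) => w we.
  exists (inr e) => //=; rewrite exz; apply/fintype.subsetP => a.
  by rewrite !inE => /orP[]/eqP->.
have [a [b [eab e0 e1]]] := draw_edge_ends D e.
move: le; rewrite e0 e1; have := eab; rewrite exz => /set2_inj[] [-> ->] //.
exact: linked_sym.
Qed.

Definition away (delta : R) : set (R * R) :=
  [set z | forall w, drawing_support D w -> delta <= `|z - w|].

(** Being linked at some positive distance from the drawing is an equivalence relation; around [x],
    a ball of half the distance of [x] from the drawing serves. *)
Lemma linked_face (F : set (R * R)) x y : is_face D F -> F x -> F y ->
  exists2 delta, 0 < delta & linked (away delta) x y.
Proof.
move=> [p np ->]; set F' := connected_component _ _ => Fx Fy.
have away_le d d' : d' <= d -> away d `<=` away d'.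
  by move=> dd z zd w /zd; apply: le_trans.
move: x y Fx Fy; apply: (@connected_equiv _ F').
- exact: component_connected.
- by move=> x y _ _ [d d0 l]; exists d => //; apply: linked_sym.
- move=> x y z _ _ _ [d d0 l] [d' d'0 l']; exists (Order.min d d').
    by rewrite lt_min d0 d'0.
  by apply: (@linked_trans _ _ _ y); [apply: linked_sub l | apply: linked_sub l'];
    apply: away_le; rewrite ge_min lexx ?orbT.
- move=> x Fx; have [|d d0 dP] := @far_apart_support x.
    exact: connected_component_sub Fx.
  exists (ball x (d / 2)); first by apply: nbhsx_ballx; lra.
  move=> y _; rewrite -ball_normE /= distrC => yx; exists (d / 2); first lra.
  have xx : `|x - x| <= d / 2 by rewrite subrr normr0; lra.
  apply: linked_sub (linked_ball xx (ltW yx)) => z /= zx w sw.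
  have dxw := dP x w erefl sw.
  have tri : `|x - w| <= `|z - x| + `|z - w|.
    by rewrite [`|z - x|]distrC; apply: le_trans (ler_normD _ _); rewrite addrA subrK.
  by lra.
Qed.

(* The new edge from [p] to [v] runs inside the face up to a point close to [v]
   and then straight to [v]; the last part may meet the edges at [v] only. *)
Lemma apex_edge (F : set (R * R)) p (v : G) : is_face D F -> F p ->
  closure F (draw_vertex D v) ->
  exists2 K, linked K p (draw_vertex D v) &
    forall X : {set G}, v \notin X -> far_apart K (subdrawing X).
Proof.
move=> faceF Fp clv.
(* The distance of [v] from all vertices and edges avoiding it, so the ball of radius [d / 2] can
   meet only the edges at [v]. *)
have [|d d0 dP] := @far_apart_subdrawing [set v]%SET (~: [set v])%SET.
  by rewrite finset.disjoints_subset finset.setCK.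
have d20 : 0 < d / 2 by lra.
have [q [Fq]] := clv _ (nbhsx_ballx (draw_vertex D v) _ d20).
rewrite -ball_normE /= distrC => qv.
have [d' d'0 l] := linked_face faceF Fp Fq.
pose B := [set z | `|z - draw_vertex D v| <= d / 2].
exists (away d' `|` B).
  apply: (@linked_trans _ _ _ q); first by apply: linked_sub l; left.
  have vv : `|draw_vertex D v - draw_vertex D v| <= d / 2 by rewrite subrr normr0 ltW.
  by apply: linked_sub (linked_ball (ltW qv) vv); right.
move=> X vX; exists (Order.min d' (d / 2)); first by rewrite lt_min d'0 d20.
move=> z w [az|Bz] Xw; rewrite ge_min; apply/orP; [left|right].
  by apply: az; rewrite drawing_supportE; apply: subdrawing_sub Xw; apply: finset.subsetT.
have dvw : d <= `|draw_vertex D v - w|.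
  apply: dP; first by exists (inl v); rewrite /= ?finset.sub1set ?finset.set11.
  apply: subdrawing_sub Xw; by rewrite finset.subsetC finset.sub1set inE.
have tri : `|draw_vertex D v - w| <= `|z - draw_vertex D v| + `|z - w|.
  by rewrite [`|z - draw_vertex D v|]distrC; apply: le_trans (ler_normD _ _); rewrite addrA subrK.
by move: Bz; rewrite /B /=; lra.
Qed.

End Drawing.

(** In the K5, [p] has index 0 and the branch vertices have indices 1 to 4. *)
Theorem outerplanar_K4_free (R : realType) (G : sgraph) : outerplanar R G ->
  ~ K4_linked (@adj G).
Proof.
move=> [D [F [faceF _ clF]]] [a [b [c [d [ab [ac [ad [bc [bd [cd]]]]]]]]]].
move=> [[jab jac jad] [jbc jbd jcd] [dab dac dad]].
have [p np FE] := faceF.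
have Fp : F p by rewrite FE; apply: connected_component_refl.
have [Ka la fa] := apex_edge faceF Fp (clF a).
have [Kb lb fb] := apex_edge faceF Fp (clF b).
have [Kc lc fc] := apex_edge faceF Fp (clF c).
have [Kd ld fd] := apex_edge faceF Fp (clF d).
pose V := draw_vertex D; pose S := subdrawing D.
pose P i := nth p [:: p; V a; V b; V c; V d] i.
pose K i j := match i, j with
  | 0, 1 => Ka | 0, 2 => Kb | 0, 3 => Kc | 0, 4 => Kd
  | 1, 2 => S ab | 1, 3 => S ac | 1, 4 => S ad
  | 2, 3 => S bc | 2, 4 => S bd | 3, 4 => S cd | _, _ => set0 end%N.
apply: (@no_K5_linked R P K).
  by move=> [|[|[|[|[|i]]]]] [|[|[|[|[|j]]]]] //=; rewrite ?andbF // => _;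
    rewrite /P /K /S /=; first [done | apply: linked_subdrawing].
(* Disjointness of opposite paths keeps each branch vertex off the paths between the other three, as
   [apex_edge] requires. *)
have notin (x y : G) (X Y : {set G}) : [disjoint X & Y]%B -> joined (@adj G) X x y ->
    (x \notin Y) && (y \notin Y).
  by move=> XY /and3P[xX yX _]; rewrite !(disjointFr XY).
have /andP[na1 nb1] := notin _ _ _ _ dab jab.
have /andP[na2 nc2] := notin _ _ _ _ dac jac.
have /andP[na3 nd3] := notin _ _ _ _ dad jad.
rewrite disjoint_sym in dab; have /andP[nc1 nd1] := notin _ _ _ _ dab jcd.
rewrite disjoint_sym in dac; have /andP[nb2 nd2] := notin _ _ _ _ dac jbd.
rewrite disjoint_sym in dad; have /andP[nb3 nc3] := notin _ _ _ _ dad jbc.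
have f1 := far_apart_subdrawing D dab; have f2 := far_apart_subdrawing D dac.
have f3 := far_apart_subdrawing D dad.
move=> [|[|[|[|[|i]]]]] [|[|[|[|[|j]]]]] k l //=; rewrite ?andbF // => _;
  case: k => [|[|[|[|[|k]]]]]; case: l => [|[|[|[|[|l]]]]] //=; rewrite ?andbF //= => _ _;
  rewrite /K /S; try (by [|apply: fa|apply: fb|apply: fc|apply: fd]);
  by apply: far_apart_sym; first [exact: f1 | exact: f2 | exact: f3
    | exact: fa | exact: fb | exact: fc | exact: fd].
Qed.

Theorem theorem8 (R : realType) (G : sgraph) (hG : outerplanar R G) :
  (tlir G <= 3)%N.
Proof.
have [col colP] := colorable3 (outerplanar_K4_free hG).
by rewrite /tlir; case: ex_minnP => m _; apply; apply: tlir_colorable_of_3coloring colP.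
Qed.
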